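(* Let $M$ be a Kähler manifold of real dimension $2n$, with metric $g_{ab}$, Kähler form $J_{ab}$ and Levi-Civita connection $\nabla_a$. The symplectic tractor connection on $\mathcal{T}=\Lambda^0\oplus\Lambda^1\oplus\Lambda^0$ determined by $(J_{ab},\nabla_a)$ is symplectically flat if and only if the metric $g_{ab}$ has constant holomorphic sectional curvature.
   Context: Abstract index notation is used. $\Lambda^k$ is the bundle of $k$-forms. $J_a{}^b=J_{ac}g^{bc}$ is the complex structure, and $J^{ab}$ is the skew inverse of the Kähler form, normalised by $J_{ab}J^{ac}=\delta_b{}^c$. The curvature is defined by $(\nabla_a\nabla_b-\nabla_b\nabla_a)X^c=R_{ab}{}^c{}_dX^d$. The *symplectic tractor connection* is $$\nabla_a\begin{bmatrix}\sigma\\ \mu_b\\ \rho\end{bmatrix}=\begin{bmatrix}\nabla_a\sigma-\mu_a\\ \nabla_a\mu_b+J_{ab}\rho+\Phi_{ab}\sigma\\ \nabla_a\rho-\Phi_{ab}J^{bc}\mu_c+S_a\sigma\end{bmatrix},\qquad \Phi_{bd}=\tfrac1{2(n+1)}R_{ab}{}^a{}_d,\quad S_a=\tfrac1{2n+1}J^{bc}\nabla_c\Phi_{ab}.$$ A connection on a vector bundle $E$ is *symplectically flat* if there is an endomorphism $\Theta$ of $E$ with $(\nabla_a\nabla_b-\nabla_b\nabla_a)\Sigma=2J_{ab}\Theta\Sigma$ for all sections $\Sigma$. Constancy of holomorphic sectional curvature is expressed by $$R_{ab}{}^c{}_d=\Lambda(\delta_a{}^cg_{bd}-\delta_b{}^cg_{ad}+J_a{}^cJ_{bd}-J_b{}^cJ_{ad}+2J_{ab}J^c{}_d),$$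 where indices are raised with $g^{ab}$.
   Formalization: The Kähler manifold is assumed connected and of real dimension 2n with n ≥ 2; for n = 1 every metric is symplectically flat, and on a disconnected manifold the constant may differ between components, so the claim fails there. *)

(* Defs.v *)
(* Everything is written in the real coordinates of a holomorphic atlas.      *)
(* Coordinates and tangent vectors are row vectors, so that the real Jacobian *)
(* of a coordinate change y = y(x) is the matrix A_ab = d y^b / d x^a, and    *)
(* tangent vectors transform by v |-> v *m A.  A tensor field is a family of  *)
(* component functions, one for each chart and meaningful only on the image   *)
(* of that chart, related by the usual transformation laws.                   *)
From HB Require Import structures.
From mathcomp Require Import all_boot all_order all_algebra.
From mathcomp Require Import all_classical all_reals all_analysis.

Set Implicit Arguments.
Unset Strict Implicit.
Unset Printing Implicit Defensive.

Import Order.TTheory GRing.Theory Num.Theory.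
Import numFieldNormedType.Exports.

Local Open Scope classical_set_scope.
Local Open Scope ring_scope.

Definition pderiv (R : realType) (m : nat) (a : 'I_m)
    (f : 'rV[R]_m -> R) (x : 'rV[R]_m) : R :=
  'D_(delta_mx 0 a) (f : 'rV[R]_m -> R^o) x.

(* Meant for open U. *)
Fixpoint Ck_on (R : realType) (m k : nat) (U : set 'rV[R]_m)
    (f : 'rV[R]_m -> R) : Prop :=
  (forall x, U x -> {for x, continuous f}) /\
  (if k is k'.+1 then
     forall a : 'I_m,
       (forall x, U x ->
          derivable (f : 'rV[R]_m -> R^o) x (delta_mx 0 a)) /\
       Ck_on k' U (pderiv a f)
   else True).

Definition smooth_on (R : realType) (m : nat) (U : set 'rV[R]_m)
    (f : 'rV[R]_m -> R) : Prop :=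
  forall k, Ck_on k U f.

Definition jac (R : realType) (m : nat) (y : 'rV[R]_m -> 'rV[R]_m)
    (x : 'rV[R]_m) : 'M[R]_m :=
  \matrix_(a, b) pderiv a (fun z => y z 0 b) x.

(* Multiplication by i on R^(2n) = C^n, acting on row vectors, where          *)
(* z_k = x_k + i x_(n+k): e_k |-> e_(n+k) and e_(n+k) |-> - e_k.              *)
Definition std_J (R : realType) (n : nat) : 'M[R]_(n + n) :=
  block_mx 0 1%:M (- 1%:M) 0.

(* A holomorphic atlas: the transition maps are smooth and their real         *)
(* Jacobians are complex linear (the Cauchy-Riemann equations).               *)
Record complexManifold (R : realType) (n : nat) := ComplexManifold {
  mcarrier :> topologicalType;
  mhausdorff : hausdorff_space mcarrier;
  msecond_countable : @second_countable mcarrier;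
  mindex : Type;
  mdom : mindex -> set mcarrier;
  mchart : mindex -> mcarrier -> 'rV[R]_(n + n);
  mchart_inv : mindex -> 'rV[R]_(n + n) -> mcarrier;
  mcover : forall p : mcarrier, exists i, mdom i p;
  mdom_open : forall i, open (mdom i);
  mimg_open : forall i, open (mchart i @` mdom i);
  mchartK : forall i p, mdom i p -> mchart_inv i (mchart i p) = p;
  mchart_continuous : forall i p, mdom i p -> {for p, continuous (mchart i)};
  mchart_inv_continuous : forall i x, (mchart i @` mdom i) x ->
    {for x, continuous (mchart_inv i)};
  mtransition_smooth : forall i j (b : 'I_(n + n)),
    smooth_on (mchart i @` (mdom i `&` mdom j))
      (fun x => mchart j (mchart_inv i x) 0 b);
  mtransition_holomorphic : forall i j x,
    (mchart i @` (mdom i `&` mdom j)) x ->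
    std_J R n *m jac (fun z => mchart j (mchart_inv i z)) x =
    jac (fun z => mchart j (mchart_inv i z)) x *m std_J R n
}.

Definition chart_img (R : realType) (n : nat) (M : complexManifold R n)
    (i : mindex M) : set 'rV[R]_(n + n) :=
  mchart i @` mdom i.

Definition overlap (R : realType) (n : nat) (M : complexManifold R n)
    (i j : mindex M) : set 'rV[R]_(n + n) :=
  mchart i @` (mdom i `&` mdom j).

Definition transition (R : realType) (n : nat) (M : complexManifold R n)
    (i j : mindex M) (x : 'rV[R]_(n + n)) : 'rV[R]_(n + n) :=
  mchart j (mchart_inv i x).

(* J_ab = J_a^c g_cb, that is J_a^b = J_ac g^bc with J_a^b the complex        *)
(* structure of the manifold.                                                 *)
Definition kahler_form (R : realType) (n : nat)
    (g : 'rV[R]_(n + n) -> 'M[R]_(n + n)) (x : 'rV[R]_(n + n)) :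
    'M[R]_(n + n) :=
  std_J R n *m g x.

(* A Hermitian metric whose fundamental form is closed. *)
Record kahlerMetric (R : realType) (n : nat) (M : complexManifold R n) :=
  KahlerMetric {
  metric :> mindex M -> 'rV[R]_(n + n) -> 'M[R]_(n + n);
  metric_smooth : forall i (a b : 'I_(n + n)),
    smooth_on (chart_img i) (fun x => metric i x a b);
  metric_tensor : forall i j x, overlap i j x ->
    metric i x = jac (transition i j) x *m metric j (transition i j x)
                   *m (jac (transition i j) x)^T;
  metric_sym : forall i x, chart_img i x -> (metric i x)^T = metric i x;
  metric_pos : forall i x, chart_img i x ->
    forall v : 'rV[R]_(n + n), v != 0 -> 0 < (v *m metric i x *m v^T) 0 0;
  metric_hermitian : forall i x, chart_img i x ->
    std_J R n *m metric i x *m (std_J R n)^T = metric i x;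
  kahler_closed : forall i x, chart_img i x -> forall a b c : 'I_(n + n),
    pderiv a (fun z => kahler_form (metric i) z b c) x
    + pderiv b (fun z => kahler_form (metric i) z c a) x
    + pderiv c (fun z => kahler_form (metric i) z a b) x = 0
}.

(* christoffel g c a b x = Gamma^c_ab for the Levi-Civita connection of g. *)
Definition christoffel (R : realType) (m : nat)
    (g : 'rV[R]_m -> 'M[R]_m) (c a b : 'I_m) (x : 'rV[R]_m) : R :=
  2^-1 * \sum_d invmx (g x) c d *
    (pderiv a (fun z => g z b d) x + pderiv b (fun z => g z a d) x
     - pderiv d (fun z => g z a b) x).

(* Below Gam c a b = Gamma^c_ab is a torsion-free connection, with            *)
(* nabla_a X^c = d_a X^c + Gamma^c_ab X^b.                                    *)

(* curv Gam a b c d x = R_ab^c_d, where                                       *)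
(* (nabla_a nabla_b - nabla_b nabla_a) X^c = R_ab^c_d X^d.                    *)
Definition curv (R : realType) (m : nat)
    (Gam : 'I_m -> 'I_m -> 'I_m -> 'rV[R]_m -> R)
    (a b c d : 'I_m) (x : 'rV[R]_m) : R :=
  pderiv a (Gam c b d) x - pderiv b (Gam c a d) x
  + \sum_e (Gam c a e x * Gam e b d x - Gam c b e x * Gam e a d x).

Definition cov1 (R : realType) (m : nat)
    (Gam : 'I_m -> 'I_m -> 'I_m -> 'rV[R]_m -> R)
    (mu : 'rV[R]_m -> 'rV[R]_m) (a b : 'I_m) (x : 'rV[R]_m) : R :=
  pderiv a (fun z => mu z 0 b) x - \sum_c Gam c a b x * mu x 0 c.

(* cov2 Gam Phi c a b x = nabla_c Phi_ab *)
Definition cov2 (R : realType) (m : nat)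
    (Gam : 'I_m -> 'I_m -> 'I_m -> 'rV[R]_m -> R)
    (Phi : 'rV[R]_m -> 'M[R]_m) (c a b : 'I_m) (x : 'rV[R]_m) : R :=
  pderiv c (fun z => Phi z a b) x
  - \sum_e Gam e c a x * Phi x e b - \sum_e Gam e c b x * Phi x a e.

(* The fibre of T = Lambda^0 (+) Lambda^1 (+) Lambda^0 in a chart:            *)
(* Sig = (sigma, mu_b, rho).                                                  *)
Notation tractor R m := (R^o * 'rV[R]_m * R^o)%type.

Section SymplecticTractorConnection.
Context (R : realType) (n : nat).
Context (J : 'rV[R]_(n + n) -> 'M[R]_(n + n))
  (Gam : 'I_(n + n) -> 'I_(n + n) -> 'I_(n + n) -> 'rV[R]_(n + n) -> R).

(* J^ab, determined by J_ab J^ac = delta_b^c. *)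
Definition Jinv (x : 'rV[R]_(n + n)) : 'M[R]_(n + n) := invmx (J x)^T.

Definition tractor_Phi (x : 'rV[R]_(n + n)) : 'M[R]_(n + n) :=
  \matrix_(b, d) ((2 * n.+1)%:R^-1 * \sum_a curv Gam a b a d x).

Definition tractor_S (a : 'I_(n + n)) (x : 'rV[R]_(n + n)) : R :=
  (2 * n + 1)%:R^-1 *
    \sum_b \sum_c Jinv x b c * cov2 Gam tractor_Phi c a b x.

Definition tractor_nabla (a : 'I_(n + n))
    (Sig : 'rV[R]_(n + n) -> tractor R (n + n)) (x : 'rV[R]_(n + n)) :
    tractor R (n + n) :=
  let sigma := fun z => (Sig z).1.1 in
  let mu := fun z => (Sig z).1.2 in
  let rho := fun z => (Sig z).2 in
  (pderiv a sigma x - mu x 0 a,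
   \row_b (cov1 Gam mu a b x + J x a b * rho x + tractor_Phi x a b * sigma x),
   pderiv a rho x
     - (\sum_b \sum_c tractor_Phi x a b * Jinv x b c * mu x 0 c)
     + tractor_S a x * sigma x).

(* nabla_a nabla_b Sig: the outer derivative is the connection on             *)
(* Lambda^1 (x) T obtained by coupling with nabla on Lambda^1.                *)
Definition tractor_nabla2 (a b : 'I_(n + n))
    (Sig : 'rV[R]_(n + n) -> tractor R (n + n)) (x : 'rV[R]_(n + n)) :
    tractor R (n + n) :=
  tractor_nabla a (tractor_nabla b Sig) x
  - \sum_e Gam e a b x *: tractor_nabla e Sig x.

End SymplecticTractorConnection.

Definition tractor_smooth_on (R : realType) (m : nat) (U : set 'rV[R]_m)
    (Sig : 'rV[R]_m -> tractor R m) : Prop :=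
  [/\ smooth_on U (fun x => (Sig x).1.1),
      (forall b, smooth_on U (fun x => (Sig x).1.2 0 b)) &
      smooth_on U (fun x => (Sig x).2)].

(* Change of coordinates in a fibre of T: mu_a = (d y^b / d x^a) mu'_b. *)
Definition tractor_pull (R : realType) (m : nat) (A : 'M[R]_m)
    (v : tractor R m) : tractor R m :=
  (v.1.1, v.1.2 *m A^T, v.2).

Record tractorSection (R : realType) (n : nat) (M : complexManifold R n) :=
  TractorSection {
  tsec :> mindex M -> 'rV[R]_(n + n) -> tractor R (n + n);
  tsec_smooth : forall i, tractor_smooth_on (chart_img i) (tsec i);
  tsec_compat : forall i j x, overlap i j x ->
    tsec i x = tractor_pull (jac (transition i j) x)
                 (tsec j (transition i j x))
}.

(* A smooth bundle endomorphism of T. *)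
Record tractorEnd (R : realType) (n : nat) (M : complexManifold R n) :=
  TractorEnd {
  tend :> mindex M -> 'rV[R]_(n + n) ->
          tractor R (n + n) -> tractor R (n + n);
  tend_linear : forall i x, chart_img i x -> linear (tend i x);
  tend_smooth : forall i v,
    tractor_smooth_on (chart_img i) (fun x => tend i x v);
  tend_compat : forall i j x, overlap i j x ->
    forall v,
      tend i x (tractor_pull (jac (transition i j) x) v) =
      tractor_pull (jac (transition i j) x) (tend j (transition i j x) v)
}.

Definition symplectically_flat (R : realType) (n : nat)
    (M : complexManifold R n) (g : kahlerMetric M) : Prop :=
  exists Theta : tractorEnd M, forall Sig : tractorSection M,
  forall i x, chart_img i x -> forall a b : 'I_(n + n),
    let J := kahler_form (g i) in
    let Gam := christoffel (g i) in
    tractor_nabla2 J Gam a b (Sig i) x - tractor_nabla2 J Gam b a (Sig i) x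
    = (2 * J x a b) *: Theta i x (Sig i x).

Definition constant_holomorphic_sectional_curvature (R : realType) (n : nat)
    (M : complexManifold R n) (g : kahlerMetric M) : Prop :=
  exists Lam : R, forall i x, chart_img i x -> forall a b c d : 'I_(n + n),
    let G := g i x in
    let J := kahler_form (g i) x in
    (* J_a^b = J_ac g^bc and J^a_b = g^ac J_cb *)
    let Jdu := J *m (invmx G)^T in
    let Jud := invmx G *m J in
    curv (christoffel (g i)) a b c d x =
    Lam * ((a == c)%:R * G b d - (b == c)%:R * G a d
           + Jdu a c * J b d - Jdu b c * J a d + 2 * J a b * Jud c d).

(* Main.v *)
(* The commutator of the tractor connection is algebraic in (sigma, mu, rho),
   so evaluating it on bump sections turns flatness into pointwise equations.
   The mu-part of the middle slot expresses R_ab^c_d through Phi and Theta.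
   Lowering c and symmetrising over c and d, a trace gives
   (tr Phi) g - 2n Phi = 2 J (Theta + Theta^T), whose left side commutes with J
   while its right side anticommutes with it; so both vanish, Phi = L g, and
   the Ricci trace then gives Theta = L J.  Since Theta is a smooth bundle
   endomorphism and changes of chart are holomorphic, L is a smooth function
   on M, without any appeal to the transformation law of the curvature.  The
   sigma-part of the middle slot has two traces that together give
   (4 n^2 - 4) dL = 0, so L is constant for n >= 2.  Conversely, take
   Theta (sigma, mu_b, rho) = (rho, - L J^c_b mu_c, - L^2 sigma). *)
From HB Require Import structures.
Require Import Defs.
From mathcomp Require Import all_boot all_order all_algebra.
From mathcomp Require Import all_classical all_reals all_analysis.
From mathcomp Require Import perm ring lra.

Set Implicit Arguments.
Unset Strict Implicit.
Unset Printing Implicit Defensive.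

Import Order.TTheory GRing.Theory Num.Theory.
Import numFieldNormedType.Exports.

Local Open Scope classical_set_scope.
Local Open Scope ring_scope.

(** * Partial derivatives *)

(** [Phi] contains second derivatives of the metric, and the middle slot of the curvature
    differentiates [Phi] times sigma. The curvature is therefore evaluated first on sections whose
    sigma vanishes identically, where this product is zero. That already gives Phi = L g; since L is
    read off from Theta it is smooth, and only then is [Phi] differentiated, as L times a parallel
    tensor. The bound n >= 2 is essential: for n = 1 every expression skew in a and b is a multiple
    of J_ab, so every connection is symplectically flat. Connectedness turns a locally constant L
    into a constant. Flatness is a statement about global sections, so a value prescribed at one
    point is realised by a bump in a chart, extended by zero; the Hausdorff property makes this
    extension smooth. Smoothness is expressed by iterated partial derivatives, so differentiability,
    the chain rule and the symmetry of second derivatives all rest on the mean value theorem along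
    coordinate lines. *)

Definition is_pderiv (R : realType) (m : nat) (a : 'I_m)
    (f : 'rV[R]_m -> R) (x : 'rV[R]_m) (d : R) : Prop :=
  is_derive x (delta_mx 0 a) (f : 'rV[R]_m -> R^o) d.

Section PartialDerivatives.
Context (R : realType) (m : nat).
Implicit Types (f g : 'rV[R]_m -> R) (x : 'rV[R]_m) (a b : 'I_m).

Lemma is_pderiv_val a f x d : is_pderiv a f x d -> pderiv a f x = d.
Proof. by move=> [_ <-]. Qed.

Lemma is_pderiv_derivable a f x d : is_pderiv a f x d ->
  derivable (f : 'rV[R]_m -> R^o) x (delta_mx 0 a).
Proof. by case. Qed.

Lemma derivable_is_pderiv a f x :
  derivable (f : 'rV[R]_m -> R^o) x (delta_mx 0 a) ->
  is_pderiv a f x (pderiv a f x).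
Proof. exact: derivableP. Qed.

Lemma is_pderiv_eq a f x d d' : is_pderiv a f x d -> d = d' ->
  is_pderiv a f x d'.
Proof. by move=> h <-. Qed.

Lemma is_pderiv_near a f g x d : (\near x, f x = g x) -> is_pderiv a f x d ->
  is_pderiv a g x d.
Proof. exact: near_eq_is_derive. Qed.

Lemma pderiv_near a f g x : (\near x, f x = g x) -> pderiv a f x = pderiv a g x.
Proof. exact: near_eq_derive. Qed.

Lemma is_pderiv_open U a f g x d : open U -> U x ->
  (forall z, U z -> f z = g z) -> is_pderiv a f x d -> is_pderiv a g x d.
Proof.
move=> oU Ux fg; apply: is_pderiv_near.
by near do apply: fg; exact: open_nbhs_nbhs.
Unshelve. all: by end_near. Qed.

Lemma pderiv_open U a f g x : open U -> U x ->
  (forall z, U z -> f z = g z) -> pderiv a f x = pderiv a g x.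
Proof.
move=> oU Ux fg; apply: pderiv_near.
by near do apply: fg; exact: open_nbhs_nbhs.
Unshelve. all: by end_near. Qed.

Lemma is_pderiv_cst a (c : R) x : is_pderiv a (fun=> c) x 0.
Proof. exact: is_derive_cst. Qed.

Lemma is_pderiv_coord a b x : is_pderiv a (fun z => z 0 b) x (a == b)%:R.
Proof.
have /derivable_mxP hd : derivable (id : 'rV[R]_m -> 'rV[R]_m) x (delta_mx 0 a).
  exact: derivable_id.
apply: DeriveDef; first exact: hd.
have := @derive_mx R _ 1 m id x (delta_mx 0 a) (@derivable_id _ _ _ _).
by rewrite derive_id => /matrixP/(_ 0 b); rewrite !mxE eqxx eq_sym => ->.
Qed.

Lemma is_pderivD a f g x df dg : is_pderiv a f x df -> is_pderiv a g x dg ->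
  is_pderiv a (fun z => f z + g z) x (df + dg).
Proof. exact: is_deriveD. Qed.

Lemma is_pderivB a f g x df dg : is_pderiv a f x df -> is_pderiv a g x dg ->
  is_pderiv a (fun z => f z - g z) x (df - dg).
Proof. exact: is_deriveB. Qed.

Lemma is_pderivM a f g x df dg : is_pderiv a f x df -> is_pderiv a g x dg ->
  is_pderiv a (fun z => f z * g z) x (df * g x + f x * dg).
Proof.
move=> hf hg; apply: (is_pderiv_eq (@is_deriveM R _ _ _ _ _ _ _ hf hg)).
by change (f x * dg + g x * df = df * g x + f x * dg); rewrite addrC [g x * _]mulrC.
Qed.

Lemma is_pderivZ a (c : R) f x df : is_pderiv a f x df ->
  is_pderiv a (fun z => c * f z) x (c * df).
Proof.
move=> hf; apply: is_pderiv_eq (is_pderivM (is_pderiv_cst a c x) hf) _.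
by rewrite mul0r add0r.
Qed.

Lemma is_pderivV a f x df : f x != 0 -> is_pderiv a f x df ->
  is_pderiv a (fun z => (f z)^-1) x (- (f x) ^- 2 * df).
Proof.
move=> fx0 [hd <-]; split; first exact: derivableV.
by rewrite deriveV.
Qed.

Lemma is_pderiv_sum a (I : Type) (r : seq I) (P : pred I)
    (f : I -> 'rV[R]_m -> R) (df : I -> R) x :
  (forall i, P i -> is_pderiv a (f i) x (df i)) ->
  is_pderiv a (fun z => \sum_(i <- r | P i) f i z) x (\sum_(i <- r | P i) df i).
Proof.
move=> h; elim: r => [|i r IH].
  rewrite big_nil (_ : (fun z => _) = fun=> 0); first exact: is_pderiv_cst.
  by apply/funext => z; rewrite big_nil.
rewrite big_cons; set F := fun z => _.
have -> : F = fun z => if P i then f i z + \sum_(j <- r | P j) f j z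
                       else \sum_(j <- r | P j) f j z.
  by apply/funext => z; rewrite /F big_cons.
by case: ifP => // Pi; apply: is_pderivD => //; exact: h.
Qed.

(** The derivative is left existential: the sole use is the derivability of determinants and
    cofactors, where Leibniz' formula would be a burden. *)
Lemma derivable_prod a (I : Type) (r : seq I) (P : pred I)
    (f : I -> 'rV[R]_m -> R) x :
  (forall i, P i -> exists d, is_pderiv a (f i) x d) ->
  exists d, is_pderiv a (fun z => \prod_(i <- r | P i) f i z) x d.
Proof.
move=> h; elim: r => [|i r [d IH]].
  exists 0; rewrite (_ : (fun z => _) = fun=> 1); first exact: is_pderiv_cst.
  by apply/funext => z; rewrite big_nil.
have -> : (fun z => \prod_(j <- i :: r | P j) f j z) =
    fun z => if P i then f i z * \prod_(j <- r | P j) f j z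
             else \prod_(j <- r | P j) f j z.
  by apply/funext => z; rewrite big_cons.
case: (P i) (h i) => [/(_ isT)[d' hd']|_]; last by exists d.
by exists (d' * (\prod_(i <- r | P i) f i x) + f i x * d);
  exact: is_pderivM.
Qed.

Lemma derivable_sum_ex a (I : Type) (r : seq I) (P : pred I)
    (f : I -> 'rV[R]_m -> R) x :
  (forall i, P i -> exists d, is_pderiv a (f i) x d) ->
  exists d, is_pderiv a (fun z => \sum_(i <- r | P i) f i z) x d.
Proof.
move=> h; exists (\sum_(i <- r | P i) pderiv a (f i) x).
by apply: is_pderiv_sum => i /h[d] /is_pderiv_derivable /derivable_is_pderiv.
Qed.

Lemma derivable_det a k (A : 'rV[R]_m -> 'M[R]_k) x :
  (forall i j, exists d, is_pderiv a (fun z => A z i j) x d) ->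
  exists d, is_pderiv a (fun z => \det (A z)) x d.
Proof.
move=> h; apply: derivable_sum_ex => s _.
have [d hd] := @derivable_prod a _ (index_enum 'I_k) xpredT
  (fun i z => A z i (s i)) x (fun i _ => h i (s i)).
by exists ((-1) ^+ s * d); exact: is_pderivZ.
Qed.

(** Cramer's rule: each entry of the inverse is a cofactor over the determinant. [invmx] agrees with
    that quotient only at invertible matrices, so invertibility is required on a whole open set. *)
Lemma derivable_invmx a k (A : 'rV[R]_m -> 'M[R]_k) U x : open U -> U x ->
  (forall z, U z -> A z \in unitmx) ->
  (forall i j, exists d, is_pderiv a (fun z => A z i j) x d) ->
  forall i j, exists d, is_pderiv a (fun z => invmx (A z) i j) x d.
Proof.
move=> oU Ux uA h i j.
have [d hd] := derivable_det h.
have [d' hd'] : exists d, is_pderiv a (fun z => \det (row' j (col' i (A z)))) x d.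
  apply: derivable_det => k1 k2.
  have -> : (fun z => row' j (col' i (A z)) k1 k2) =
            fun z => A z (lift j k1) (lift i k2).
    by apply/funext => z; rewrite !mxE.
  exact: h.
eexists; apply: (is_pderiv_open
  (f := fun z => (\det (A z))^-1 * ((-1) ^+ (j + i) * \det (row' j (col' i (A z)))))
  oU Ux).
  by move=> z Uz; rewrite /invmx uA // !mxE.
apply: is_pderivM; last exact: is_pderivZ hd'.
by apply: is_pderivV hd; have := uA _ Ux; rewrite unitmxE unitfE.
Qed.

(** Passing to a coordinate line leaves the difference quotients unchanged, which opens the way to
    the one-variable mean value theorem. *)
Lemma is_derive_line a f x (t d : R) :
  is_pderiv a f (t *: delta_mx 0 a + x) d ->
  is_derive t (1 : R) (fun s : R => f (s *: delta_mx 0 a + x) : R^o) d.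
Proof.
have E : (fun h : R => h^-1 *: (f (h *: delta_mx 0 a + (t *: delta_mx 0 a + x)) -
    f (t *: delta_mx 0 a + x))) =
  (fun h : R => h^-1 *: (f ((h *: 1 + t) *: delta_mx 0 a + x) -
    f (t *: delta_mx 0 a + x))).
  by apply/funext => h; rewrite [h *: 1]mulr1 scalerDl addrA.
move=> [h1 h2]; split.
  by move: h1; rewrite /derivable /= E.
by move: h2; rewrite /derive /= E.
Qed.

(** Stated for [s] and [t] in either order, because the coordinates of two points of the space are
    not ordered alike. *)
Lemma mean_value (p dp : R -> R) (s t : R) :
  (forall c, Num.min s t <= c <= Num.max s t -> is_derive c (1 : R) (p : R -> R^o) (dp c)) ->
  exists2 c, Num.min s t <= c <= Num.max s t & p t - p s = dp c * (t - s).
Proof.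
have aux (u v : R) : u <= v ->
    (forall c, u <= c <= v -> is_derive c (1 : R) (p : R -> R^o) (dp c)) ->
    exists2 c, u <= c <= v & p v - p u = dp c * (v - u).
  move=> uv h; have [||c] := @MVT_segment R p dp u v uv.
  - by move=> c /[!in_itv]/= /andP[c1 c2]; apply: h; rewrite !ltW.
  - apply: derivable_within_continuous => c /[!in_itv]/= hc.
    by have [] := h _ hc.
  - by rewrite in_itv /=; exists c.
have [st|/ltW ts] := leP s t; first exact: aux.
move=> /(aux _ _ ts)[c hc e]; exists c => //.
by rewrite -opprB e -mulrN opprB.
Qed.

End PartialDerivatives.

(** * Functions of class C^k *)

Section CkClosure.
Context (R : realType) (m : nat).
Implicit Types (f g : 'rV[R]_m -> R) (x : 'rV[R]_m) (a b : 'I_m)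
  (U V : set 'rV[R]_m) (k : nat).

Lemma Ck_on_continuous k U f x : Ck_on k U f -> U x -> {for x, continuous f}.
Proof. by case: k => [|k] [h _]; exact: h. Qed.

Lemma Ck_on_is_pderiv k U f x a : Ck_on k.+1 U f -> U x ->
  is_pderiv a f x (pderiv a f x).
Proof.
by move=> [_ h] Ux; apply: derivable_is_pderiv; exact: (h a).1.
Qed.

(** Continuity and derivability are asked at points of the ambient space, not relative to [U], so
    the pieces [V] may be arbitrary sets. *)
Lemma Ck_on_local k U f :
  (forall x, U x -> exists2 V, V x & Ck_on k V f) -> Ck_on k U f.
Proof.
elim: k f => [|k IH] f h; (split; first by
  move=> x /h[V Vx hV]; exact: Ck_on_continuous hV Vx) => //.
move=> a; split=> [x /h[V Vx [_ /(_ a) [hV _]]]|]; first exact: hV.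
by apply: IH => x /h[V Vx [_ /(_ a) [_ hV]]]; exists V.
Qed.

Lemma Ck_on_eq k U f g : open U -> (forall x, U x -> f x = g x) ->
  Ck_on k U f -> Ck_on k U g.
Proof.
move=> oU; have ct f' g' x : (forall x, U x -> f' x = g' x) -> U x ->
    {for x, continuous f'} -> {for x, continuous g'}.
  move=> fg Ux cf; have E : \near x, f' x = g' x.
    by near do apply: fg; exact: open_nbhs_nbhs.
  rewrite /prop_for /continuous_at -(fg x Ux).
  by apply: cvg_trans cf; apply: (near_eq_cvg E).
elim: k f g => [|k IH] f g fg [cf df]; (split; first by
  move=> x Ux; exact: (ct _ _ _ fg Ux (cf _ Ux))) => // a; split.
  move=> x Ux; apply: (is_pderiv_derivable
    (is_pderiv_open oU Ux fg (derivable_is_pderiv _))).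
  exact: (df a).1.
apply: IH (df a).2 => x Ux; exact: pderiv_open oU Ux fg.
Unshelve. all: by end_near. Qed.

Lemma Ck_onS k U f : Ck_on k.+1 U f -> Ck_on k U f.
Proof.
elim: k f => [|k IH] f [cf df]; split=> // a.
by have [h1 h2] := df a; split=> //; exact: IH.
Qed.

Lemma Ck_on_cst k U (c : R) : Ck_on k U (fun=> c).
Proof.
elim: k c => [|k IH] c; (split; first by move=> x _; exact: cst_continuous) => // a.
split=> [x _|]; first exact: is_pderiv_derivable (is_pderiv_cst a c x).
rewrite (_ : pderiv a _ = fun=> 0) //.
by apply/funext => x; rewrite (is_pderiv_val (is_pderiv_cst a c x)).
Qed.

Lemma Ck_on_coord k U b : Ck_on k U (fun x => x 0 b).
Proof.
have ct x : {for x, continuous (fun x : 'rV[R]_m => x 0 b)}.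
  exact: coord_continuous.
case: k => [|k]; split=> // a; split=> [x _|].
  exact: is_pderiv_derivable (is_pderiv_coord a b x).
rewrite (_ : pderiv a _ = fun=> (a == b)%:R); first exact: Ck_on_cst.
by apply/funext => x; rewrite (is_pderiv_val (is_pderiv_coord a b x)).
Qed.

Lemma Ck_onD k U f g : open U -> Ck_on k U f -> Ck_on k U g ->
  Ck_on k U (fun x => f x + g x).
Proof.
move=> oU; elim: k f g => [|k IH] f g hf hg; (split; first by
  move=> x Ux; apply: (@continuousD R R^o _ f g);
     [exact: Ck_on_continuous hf Ux|exact: Ck_on_continuous hg Ux]) => // a.
have h x : U x -> is_pderiv a (fun x => f x + g x) x (pderiv a f x + pderiv a g x).
  by move=> Ux; apply: is_pderivD; apply: (Ck_on_is_pderiv _ _ Ux); eassumption.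
split=> [x /h|]; first exact: is_pderiv_derivable.
apply: Ck_on_eq (IH _ _ (hf.2 a).2 (hg.2 a).2) => // x /h h'.
by rewrite (is_pderiv_val h').
Qed.

Lemma Ck_onM k U f g : open U -> Ck_on k U f -> Ck_on k U g ->
  Ck_on k U (fun x => f x * g x).
Proof.
move=> oU; elim: k f g => [|k IH] f g hf hg; (split; first by
  move=> x Ux; apply: (@continuousM R _ f g);
     [exact: Ck_on_continuous hf Ux|exact: Ck_on_continuous hg Ux]) => // a.
have h x : U x -> is_pderiv a (fun x => f x * g x) x
    (pderiv a f x * g x + f x * pderiv a g x).
  by move=> Ux; apply: is_pderivM; apply: (Ck_on_is_pderiv _ _ Ux); eassumption.
split=> [x /h|]; first exact: is_pderiv_derivable.
apply: (@Ck_on_eq _ _ (fun x => pderiv a f x * g x + f x * pderiv a g x)) => //.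
  by move=> x /h h'; rewrite (is_pderiv_val h').
apply: Ck_onD => //; apply: IH; solve [exact: (hf.2 a).2|exact: (hg.2 a).2
  |exact: Ck_onS].
Qed.

Lemma Ck_onN k U f : open U -> Ck_on k U f -> Ck_on k U (fun x => - f x).
Proof.
move=> oU hf; apply: Ck_on_eq (Ck_onM oU (Ck_on_cst k U (-1)) hf) => // x _.
by rewrite mulN1r.
Qed.

Lemma Ck_on_sum k U (I : Type) (r : seq I) (P : pred I)
    (f : I -> 'rV[R]_m -> R) : open U -> (forall i, P i -> Ck_on k U (f i)) ->
  Ck_on k U (fun z => \sum_(i <- r | P i) f i z).
Proof.
move=> oU h; elim: r => [|i r IH].
  rewrite (_ : (fun z => _) = fun=> 0); first exact: Ck_on_cst.
  by apply/funext => z; rewrite big_nil.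
have -> : (fun z => \sum_(j <- i :: r | P j) f j z) =
    fun z => if P i then f i z + \sum_(j <- r | P j) f j z
             else \sum_(j <- r | P j) f j z.
  by apply/funext => z; rewrite big_cons.
by case: (P i) (h i) => [/(_ isT) hi|_] //; exact: Ck_onD.
Qed.

Lemma smooth_on_pderiv U f a : smooth_on U f -> smooth_on U (pderiv a f).
Proof. by move=> h k; have [_ /(_ a)[]] := h k.+1. Qed.

Lemma smooth_on_is_pderiv U f x a : smooth_on U f -> U x ->
  is_pderiv a f x (pderiv a f x).
Proof. by move=> h; exact: Ck_on_is_pderiv (h 1%N). Qed.

Lemma smooth_on_continuous U f x : smooth_on U f -> U x -> {for x, continuous f}.
Proof. by move=> h; exact: Ck_on_continuous (h 0%N). Qed.

(* Telescopes along the path from [x] to [y] whose k-th vertex has its first k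
   coordinates taken from [y] and the others from [x]. *)
Lemma mean_value_rV (r : R) f x y :
  (forall z a, `|z - x| < r -> is_pderiv a f z (pderiv a f z)) ->
  `|y - x| < r ->
  exists xi : 'I_m -> 'rV[R]_m, (forall a, `|xi a - x| <= `|y - x|) /\
    f y - f x = \sum_a pderiv a f (xi a) * (y 0 a - x 0 a).
Proof.
move=> hf yx; pose p k : 'rV[R]_m := \row_j if (j < k)%N then y 0 j else x 0 j.
have pS (a : 'I_m) (s : R) : s *: delta_mx 0 a + (p a - x 0 a *: delta_mx 0 a) =
    \row_j if (j < a)%N then y 0 j else if j == a then s else x 0 j.
  apply/rowP => j; rewrite !mxE eqxx /=; have [->|ja] := eqVneq j a.
    by rewrite ltnn !mulr1 subrr addr0.
  by rewrite !mulr0 subr0 add0r; case: ifP.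
have pS0 (a : 'I_m) : p a =
    x 0 a *: delta_mx 0 a + (p a - x 0 a *: delta_mx 0 a).
  by rewrite addrC subrK.
have pS1 (a : 'I_m) : p a.+1 =
    y 0 a *: delta_mx 0 a + (p a - x 0 a *: delta_mx 0 a).
  rewrite pS; apply/rowP => j; rewrite !mxE ltnS leq_eqVlt -val_eqE.
  by have [/val_inj ->|_] := eqVneq (val j) a; rewrite ?ltnn.
(* The norm is the largest absolute coordinate, and along the path each coordinate stays between
   those of [x] and [y]; so the path never leaves the ball around [x] that reaches [y]. *)
have near_x (a : 'I_m) (s : R) :
    Num.min (x 0 a) (y 0 a) <= s <= Num.max (x 0 a) (y 0 a) ->
    `|(s *: delta_mx 0 a + (p a - x 0 a *: delta_mx 0 a)) - x| <= `|y - x|.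
  move=> hs; rewrite pS; rewrite [leLHS]/Num.Def.normr /= mx_normrE.
  apply: bigmax_le => // -[i j] _ /=; rewrite (ord1 i) !mxE.
  have hj : `|y 0 j - x 0 j| <= `|y - x|.
    rewrite [leRHS]/Num.Def.normr /= mx_normrE.
    apply: le_trans (le_bigmax _ _ (0, j)); by rewrite !mxE.
  case: ifP => // _; have [ja|_] := eqVneq j a; last by rewrite subrr normr0.
  move: hj; rewrite ja; apply: le_trans; move: hs; have [xy|yx'] := leP (x 0 a) (y 0 a) => /andP[h1 h2].
    by rewrite !ger0_norm ?subr_ge0 // lerD2r.
  rewrite !ler0_norm ?subr_le0 ?(ltW yx') //; first by rewrite !opprB lerD2l lerN2.
have step (a : 'I_m) : exists xi, `|xi - x| <= `|y - x| /\
    f (p a.+1) - f (p a) = pderiv a f xi * (y 0 a - x 0 a).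
  pose w := p a - x 0 a *: delta_mx 0 a.
  have [c hc e] := @mean_value R (fun s => f (s *: delta_mx 0 a + w))
    (fun s => pderiv a f (s *: delta_mx 0 a + w)) (x 0 a) (y 0 a)
    (fun c hc => is_derive_line (hf _ a (le_lt_trans (near_x a c hc) yx))).
  exists (c *: delta_mx 0 a + w); split; first exact: near_x.
  by rewrite -e -pS1 -pS0.
have [xi hxi] := choice step; exists xi; split=> [a|]; first by have [] := hxi a.
have -> : f x = f (p 0%N).
  by congr f; apply/rowP => j; rewrite mxE.
have -> : f y = f (p m).
  by congr f; apply/rowP => j; rewrite mxE ltn_ord.
rewrite -(telescope_sumr (fun k => f (p k)) (leq0n m)) big_mkord.
by apply: eq_bigr => a _; have [_ ->] := hxi a.
Qed.

Lemma zero_gradient_ball (r : R) f x y :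
  (forall z a, `|z - x| < r -> is_pderiv a f z 0) -> `|y - x| < r -> f y = f x.
Proof.
move=> h yx; have [z a zx|xi [xi1 xi2]] := @mean_value_rV r f x y _ yx.
  by have H := h z a zx; rewrite (is_pderiv_val H).
apply/eqP; rewrite -subr_eq0 xi2 big1 // => a _.
by rewrite (is_pderiv_val (h _ a (le_lt_trans (xi1 a) yx))) mul0r.
Qed.

(** [mean_value_rV] writes the increment with partial derivatives at intermediate points; their
    continuity at [x] allows replacing these points by [x] at the cost of a small multiple of the
    norm of [h]. *)
Lemma C1_differentiable U f x : open U -> U x -> Ck_on 1 U f ->
  differentiable (f : 'rV[R]_m -> R^o) x.
Proof.
move=> oU Ux hf.
pose L (h : 'rV[R]_m) : R^o := \sum_a pderiv a f x * h 0 a.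
have Llin : linear L.
  move=> c u v; rewrite /L scaler_sumr -big_split /=; apply: eq_bigr => a _.
  by rewrite !mxE mulrDr mulrCA.
pose LL : {linear 'rV[R]_m -> R^o} :=
  HB.pack L (GRing.isLinear.Build _ _ _ _ _ Llin).
have Lc : continuous LL.
  move=> z; apply: (@Ck_on_continuous 0 setT) => //.
  apply: Ck_on_sum => [|a _]; first exact: openT.
  by apply: Ck_onM; [exact: openT|exact: Ck_on_cst|exact: Ck_on_coord].
pose F : 'rV[R]_m -> R^o := f.
have key : forall e : R, 0 < e -> \forall h \near (0 : 'rV[R]_m),
    `|f (h + x) - f x - L h| <= e * `|h|.
  move=> e e0.
  (* Each of the [m] coordinates contributes at most this multiple of the norm of [h]; [m.+1] in
     place of [m] keeps the quotient meaningful for [m = 0]. *)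
  have e1 : 0 < e / m.+1%:R by rewrite divr_gt0.
  have nU : \near x, U x by exact: open_nbhs_nbhs.
  have nd : \forall z \near x, forall a,
      `|pderiv a f x - pderiv a f z| <= e / m.+1%:R.
    pose P a z : Prop := `|pderiv a f x - pderiv a f z| <= e / m.+1%:R.
    apply: (@filter_forall _ _ P (nbhs x) _) => a; have := @Ck_on_continuous 0 _ _ _ (hf.2 a).2 Ux.
    by move/cvgrPdist_le; apply.
  have nb := [elaborate filterI nU nd].
  have [r /= r0 hr] := (nbhs_ballP _ _).1 nb.
  have {}hr z : `|z - x| < r -> U z /\ forall a,
      `|pderiv a f x - pderiv a f z| <= e / m.+1%:R.
    by move=> zx; apply: hr; rewrite -ball_normE /= distrC.
  near=> h.
  have hlt : `|(h + x) - x| < r.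
    by rewrite addrK; near: h; apply/nbhs_ballP; exists r => // z;
      rewrite -ball_normE /= sub0r normrN.
  have [z a /hr[Uz _]|xi [xi1 xi2]] := @mean_value_rV r f x (h + x) _ hlt.
    exact: Ck_on_is_pderiv hf Uz.
  have -> : f (h + x) - f x - L h =
      \sum_a (pderiv a f (xi a) - pderiv a f x) * h 0 a.
    rewrite xi2 /L -sumrB; apply: eq_bigr => a _.
    by rewrite !mxE addrK mulrBl.
  apply: le_trans (ler_norm_sum _ _ _) _.
  apply: (@le_trans _ _ (\sum_(a < m) (e / m.+1%:R * `|h|))).
    apply: ler_sum => a _; rewrite normrM; apply: ler_pM => //.
      by rewrite distrC; apply: (hr _ _).2; exact: le_lt_trans (xi1 a) hlt.
    rewrite [leRHS]/Num.Def.normr /= mx_normrE.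
    exact: (le_bigmax _ _ (0, a)).
  rewrite sumr_const card_ord -[leLHS]mulr_natl mulrA ler_wpM2r //.
  rewrite mulrCA ler_piMr ?(ltW e0) // ler_pdivrMr // mul1r ler_nat.
  exact: leqnSn.
have E : 'd F x = LL :> ('rV[R]_m -> R^o).
  apply: diff_unique Lc _; apply/eqaddoP => e /key; apply: filterS => h.
  by rewrite /= opprD addrA.
apply/diff_locallyP; split; first by rewrite E.
rewrite E; apply/eqaddoP => e /key; apply: filterS => h.
by rewrite /= opprD addrA.
Unshelve. all: by end_near. Qed.

End CkClosure.

(** * Symmetry of second derivatives and the chain rule *)

Lemma delta_row_norm_le1 (R : realType) (m : nat) (a : 'I_m) :
  `|delta_mx 0 a : 'rV[R]_m| <= 1.
Proof.
rewrite [leLHS]/Num.Def.normr /= mx_normrE.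
apply: bigmax_le => // -[i j] _ /=; rewrite !mxE.
by case: (_ && _); rewrite ?normr1 ?normr0.
Qed.

Opaque pderiv.

Section Clairaut.
Context (R : realType) (m : nat).
Implicit Types (f : 'rV[R]_m -> R) (x : 'rV[R]_m) (a b : 'I_m).

(** The mean value theorem in direction [a], applied to the difference of [f] in direction [b], and
    then in direction [b] applied to [pderiv a f]. The left side is symmetric in [a] and [b]. *)
Lemma second_difference f x a b (r h : R) :
  (forall z, `|z - x| < r -> is_pderiv a f z (pderiv a f z) /\
     is_pderiv b (pderiv a f) z (pderiv b (pderiv a f) z)) ->
  0 < h -> h + h < r ->
  exists2 p, `|p - x| < r &
    f (h *: delta_mx 0 a + (h *: delta_mx 0 b + x)) - f (h *: delta_mx 0 b + x)
    - f (h *: delta_mx 0 a + x) + f x = pderiv b (pderiv a f) p * h * h.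
Proof.
move=> hf h0 hr.
have bd (c t : R) : 0 <= c <= h -> 0 <= t <= h ->
    `|c *: delta_mx 0 a + (t *: delta_mx 0 b + x) - x| < r.
  move=> /andP[c0 ch] /andP[t0 th]; rewrite addrA addrK.
  apply: le_lt_trans (ler_normD _ _) _; rewrite !normrZ !ger0_norm //.
  apply: le_lt_trans hr; apply: lerD.
    by apply: le_trans ch; rewrite ler_piMr // delta_row_norm_le1.
  by apply: le_trans th; rewrite ler_piMr // delta_row_norm_le1.
have h00 : 0 <= h <= h by rewrite lexx ltW.
have h0' : 0 <= (0 : R) <= h by rewrite lexx ltW.
have m0 : Num.min 0 h = 0 by rewrite min_l // ltW.
have m1 : Num.max 0 h = h by rewrite max_r // ltW.
have d0 : (0 : R) *: delta_mx 0 b + x = x by rewrite scale0r add0r.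
have [|c hc e1] := @mean_value R
   (fun s => f (s *: delta_mx 0 a + (h *: delta_mx 0 b + x)) -
             f (s *: delta_mx 0 a + x))
   (fun s => pderiv a f (s *: delta_mx 0 a + (h *: delta_mx 0 b + x)) -
             pderiv a f (s *: delta_mx 0 a + x)) 0 h.
  rewrite m0 m1 => c hc; apply: is_deriveB; apply: is_derive_line.
    exact: (hf _ (bd _ _ hc h00)).1.
  by have := (hf _ (bd _ _ hc h0')).1; rewrite d0.
rewrite m0 m1 in hc.
have [|t ht e2] := @mean_value R
   (fun s => pderiv a f (s *: delta_mx 0 b + (c *: delta_mx 0 a + x)))
   (fun s => pderiv b (pderiv a f) (s *: delta_mx 0 b + (c *: delta_mx 0 a + x)))
   0 h.
  rewrite m0 m1 => t ht; apply: is_derive_line.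
  by rewrite addrCA; exact: (hf _ (bd _ _ hc ht)).2.
rewrite m0 m1 in ht.
exists (t *: delta_mx 0 b + (c *: delta_mx 0 a + x)).
  by rewrite addrCA; exact: bd.
move: e1; rewrite !subr0 !scale0r !add0r => e1; move: e2.
rewrite !subr0 !scale0r !add0r addrCA => e2; move: e1; rewrite e2 => <-.
by ring.
Qed.

(** Evaluating one second difference in both orders makes the two mixed derivatives agree at two
    possibly different points near [x]; their continuity at [x] transfers this to [x] itself. *)
Lemma pderivC U f x a b : open U -> U x -> Ck_on 2 U f ->
  pderiv a (pderiv b f) x = pderiv b (pderiv a f) x.
Proof.
move=> oU Ux hf.
have nU : \near x, U x by exact: open_nbhs_nbhs.
have ca : {for x, continuous (pderiv a (pderiv b f))}.
  exact: (@Ck_on_continuous _ _ 0 _ _ _ ((hf.2 b).2.2 a).2 Ux).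
have cb : {for x, continuous (pderiv b (pderiv a f))}.
  exact: (@Ck_on_continuous _ _ 0 _ _ _ ((hf.2 a).2.2 b).2 Ux).
apply/eqP; rewrite -subr_eq0 -normr_le0; apply/ler_addgt0Pl => e e0.
rewrite addr0.
have e2 : 0 < e / 2 by rewrite divr_gt0.
move/cvgrPdist_le : ca => /(_ _ e2) ca; move/cvgrPdist_le : cb => /(_ _ e2) cb.
have nb0 := [elaborate filterI ca cb].
have nb := [elaborate filterI nU nb0].
have [r /= r0 hr] := (nbhs_ballP _ _).1 nb.
have {}hr z : `|z - x| < r -> [/\ U z,
    `|pderiv a (pderiv b f) x - pderiv a (pderiv b f) z| <= e / 2 &
    `|pderiv b (pderiv a f) x - pderiv b (pderiv a f) z| <= e / 2].
  move=> zx; have bz : ball x r z by rewrite -ball_normE /= distrC.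
  have [h1 [h2 h3]] := hr z bz; exact: And3 h1 h2 h3.
have dd u v z : `|z - x| < r -> is_pderiv u f z (pderiv u f z) /\
     is_pderiv v (pderiv u f) z (pderiv v (pderiv u f) z).
  move=> /hr[Uz _ _]; split; first exact: Ck_on_is_pderiv hf Uz.
  exact: (@Ck_on_is_pderiv _ _ 0 _ _ _ _ (hf.2 u).2 Uz).
(* A square of side r / 3 fits, as [second_difference] asks twice the side to be less than r. *)
have h0 : 0 < r / 3 by rewrite divr_gt0.
have hlt : r / 3 + r / 3 < r by lra.
have [p /hr[_ _ p1] p2] := second_difference (dd a b) h0 hlt.
have [q /hr[_ q1 _] q2] := second_difference (dd b a) h0 hlt.
have pq : pderiv b (pderiv a f) p = pderiv a (pderiv b f) q.
  apply: (mulIf (lt0r_neq0 h0)); apply: (mulIf (lt0r_neq0 h0)).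
  apply: (etrans (esym p2)); apply: (etrans _ q2).
  by rewrite (addrCA (_ *: delta_mx 0 a)); ring.
rewrite -(subrK (pderiv a (pderiv b f) q) (pderiv a (pderiv b f) x)) -addrA.
apply: le_trans (ler_normD _ _) _; rewrite (splitr e); apply: lerD; first exact: q1.
by rewrite -pq distrC; exact: p1.
Qed.

End Clairaut.

Transparent pderiv.

Section ChainRule.
Context (R : realType) (m k : nat).

Lemma C1_map_differentiable (U : set 'rV[R]_m) (T : 'rV[R]_m -> 'rV[R]_k) x :
  open U -> U x -> (forall b, Ck_on 1 U (fun z => T z 0 b)) ->
  differentiable T x.
Proof.
move=> oU Ux hT.
have -> : T = \sum_b (fun z => T z 0 b *: (delta_mx 0 b : 'rV[R]_k)).
  apply/funext => z; rewrite [LHS]row_sum_delta; elim/big_ind2 : _ => //.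
  by move=> ? f ? g -> ->.
apply: differentiable_sum => b.
exact: differentiableZl (C1_differentiable oU Ux (hT b)).
Qed.

Lemma pderiv_comp (U : set 'rV[R]_m) (V : set 'rV[R]_k)
    (T : 'rV[R]_m -> 'rV[R]_k) (F : 'rV[R]_k -> R) x (a : 'I_m) :
  open U -> open V -> U x -> V (T x) ->
  (forall b, Ck_on 1 U (fun z => T z 0 b)) -> Ck_on 1 V F ->
  is_pderiv a (fun z => F (T z)) x
    (\sum_b pderiv a (fun z => T z 0 b) x * pderiv b F (T x)).
Proof.
move=> oU oV Ux Vx hT hF.
have dT := C1_map_differentiable oU Ux hT.
have dF := C1_differentiable oV Vx hF.
split; first exact/diff_derivable/differentiable_comp.
rewrite deriveE; last exact: differentiable_comp.
rewrite (diff_comp dT dF) /= -(deriveE _ dT) derive_mx; last exact: diff_derivable.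
rewrite [X in 'd _ _ X]row_sum_delta linear_sum; apply: eq_bigr => b _.
by rewrite linearZ /= mxE -(deriveE _ dF).
Qed.

End ChainRule.

(** * A flat function *)

Section FlatFunction.
Context (R : realType).

(* The factor [t^-k] makes the span of the family closed under derivation. *)
Definition flat (k : nat) (t : R) : R :=
  if 0 < t then t^-1 ^+ k * expR (- t^-1) else 0.

Lemma flat_ge0 k t : 0 <= flat k t.
Proof.
by rewrite /flat; case: ifP => // t0; rewrite mulr_ge0 ?expR_ge0 // exprn_ge0 // invr_ge0 ltW.
Qed.

Lemma flat_gt0 k t : 0 < t -> 0 < flat k t.
Proof. by move=> t0; rewrite /flat t0 mulr_gt0 ?expR_gt0 // exprn_gt0 // invr_gt0. Qed.

Lemma flat_le0 k t : t <= 0 -> flat k t = 0.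
Proof. by move=> t0; rewrite /flat ltNge t0. Qed.

Lemma flatS k t : flat k t = flat k.+1 t * t.
Proof.
rewrite /flat; case: ifP => [t0|]; last by rewrite mul0r.
by rewrite exprSr -!mulrA (mulrC (expR _) t) mulKf ?gt_eqF.
Qed.

Lemma flat_bounded k : exists2 C : R, 0 <= C & forall t, flat k t <= C.
Proof.
(* With s = 1/t, the inequality s/N <= exp(s/N) gives s^k <= N^k exp(s/N)^k, and one further factor
   exp(s/N) >= 1 completes exp(s), because N = k + 1. *)
pose N := k.+1%:R : R; exists (1 + N ^+ k); first by rewrite addr_ge0 // exprn_ge0.
move=> t; rewrite /flat; case: ifP => [t0|_]; last by rewrite addr_ge0 // exprn_ge0.
have N0 : 0 < N by rewrite ltr0n.
set s := t^-1; have s0 : 0 < s by rewrite invr_gt0.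
rewrite expRN ler_pdivrMr ?expR_gt0 //.
apply: (@le_trans _ _ (N ^+ k * expR s)); last first.
  by rewrite ler_wpM2r ?expR_ge0 // lerDr.
have -> : s = N * (s / N) by rewrite mulrCA divff ?mulr1 ?gt_eqF.
rewrite expRM_natl exprMn ler_wpM2l ?exprn_ge0 ?(ltW N0) //.
have sN0 : 0 <= s / N by rewrite divr_ge0 ?ltW.
apply: (@le_trans _ _ (expR (s / N) ^+ k)).
  apply: lerXn2r; rewrite ?nnegrE ?expR_ge0 //.
  by apply: le_trans (expR_ge1Dx _); rewrite lerDr.
rewrite exprS ler_peMl ?exprn_ge0 ?expR_ge0 //.
by rewrite -[leLHS]expR0 ler_expR.
Qed.

(** Away from 0 this is the product rule. At 0 the difference quotient equals [flat k.+2 h * h], a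
    bounded function times h, so it tends to 0. *)
Lemma is_derive_flat k t :
  is_derive t (1 : R) (flat k : R -> R^o) (flat k.+2 t - k%:R * flat k.+1 t).
Proof.
have [t0|t0|->] := ltgtP t 0.
- rewrite !(flat_le0 _ (ltW t0)) mulr0 subr0.
  apply: (@near_eq_is_derive _ _ _ (fun=> 0 : R^o)).
  by near=> z; rewrite flat_le0 // ltW //; near: z; exact: lt_nbhsl.
- apply: (@near_eq_is_derive _ _ _ (fun s : R => s^-1 ^+ k * expR (- s^-1))).
    by near=> z; rewrite /flat ifT //; near: z; exact: lt_nbhsr.
  have dV : is_derive t (1:R) (fun s : R => s^-1 : R^o) (- t ^- 2).
    have tn0 : t != 0 by rewrite gt_eqF.
    split; first exact: (@derivableV _ _ id).
    by rewrite (@deriveV _ _ id) // derive_id; exact: mulr1.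
  have dX : is_derive t (1:R) (fun s : R => s^-1 ^+ k : R^o)
      ((k%:R * t^-1 ^+ k.-1) * - t ^- 2).
    have -> : (fun s : R => s^-1 ^+ k) = (fun s : R => s^-1) ^+ k.
      apply/funext => s; elim: (k) => [|j IH]; first by rewrite !expr0.
      by rewrite !exprS IH.
    exact: is_deriveX.
  have dE : is_derive t (1:R) (fun s : R => expR (- s^-1) : R^o)
      (expR (- t^-1) * - (- t ^- 2)).
    by apply: (@is_derive1_comp R expR (fun s : R => - s^-1)); apply: is_deriveN.
  apply: (is_derive_eq (is_deriveM dX dE)).
  rewrite /flat t0 -exprVn.
  set E := expR _; set s := t^-1.
  change (s ^+ k * (E * - - s ^+ 2) + E * ((k%:R * s ^+ k.-1) * - s ^+ 2) =
    s ^+ k.+2 * E - k%:R * (s ^+ k.+1 * E)).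
  case: k {dX} => [|j] /=; first by ring.
  by rewrite !exprS; ring.
- rewrite !flat_le0 // mulr0 subr0.
  have [C C0 hC] := flat_bounded k.+2.
  have C1 : 0 < C + 1 by rewrite ltr_wpDl.
  have key : (fun h : R => h^-1 *: (flat k (h *: 1 + 0) - flat k 0) : R^o) @ 0^' --> (0 : R^o).
    apply/cvgrPdist_le => /= e e0; near=> h.
    have h0 : h != 0 by near: h; exact: nbhs_dnbhs_neq.
    rewrite sub0r normrN addr0 [h *: 1]mulr1 (flat_le0 k (lexx 0)) subr0.
    rewrite [_ *: _](_ : _ = flat k.+2 h * h); last first.
      by rewrite (flatS k) (flatS k.+1); 
      change (h^-1 * (flat k.+2 h * h * h) = flat k.+2 h * h); rewrite mulrC mulfK.
    rewrite normrM ger0_norm ?flat_ge0 //.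
    apply: (@le_trans _ _ ((C + 1) * `|h|)).
      by rewrite ler_wpM2r // (le_trans (hC h)) // lerDl.
    rewrite mulrC -ler_pdivlMr //; apply: ltW; near: h.
    apply: dnbhs0_lt.
    exact: divr_gt0.
  split; first by apply/cvg_ex; exists 0; exact: key.
  exact: cvg_lim key.
Unshelve. all: by end_near. Qed.

End FlatFunction.

Section FlatComp.
Context (R : realType) (m : nat).

Lemma is_pderiv_comp1 (U : set 'rV[R]_m) (u : 'rV[R]_m -> R) (phi : R -> R)
    (d : R) x a : open U -> U x -> Ck_on 1 U u ->
  is_derive (u x) (1 : R) (phi : R -> R^o) d ->
  is_pderiv a (fun z => phi (u z)) x (d * pderiv a u x).
Proof.
move=> oU Ux hu [hp hd].
have du := C1_differentiable oU Ux hu.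
have dp := (derivable1_diffP _ _).1 hp.
split; first by apply/diff_derivable/(@differentiable_comp _ _ R^o R^o u phi).
rewrite deriveE; last exact: (@differentiable_comp _ _ R^o R^o u phi).
rewrite (@diff_comp _ _ R^o R^o u phi x du dp) /= -(deriveE _ du).
rewrite deriv1E // derive1E hd; exact: mulrC.
Qed.

(** The induction on [k] holds for all [l] at once, because differentiating [flat l] produces the
    indices [l.+1] and [l.+2]. *)
Lemma Ck_on_flat (U : set 'rV[R]_m) (u : 'rV[R]_m -> R) k l :
  open U -> smooth_on U u -> Ck_on k U (fun z => flat l (u z)).
Proof.
move=> oU hu; have h j x a : U x -> is_pderiv a (fun z => flat j (u z)) x
    ((flat j.+2 (u x) - j%:R * flat j.+1 (u x)) * pderiv a u x).
  by move=> Ux; apply: is_pderiv_comp1 oU Ux (hu 1%N) _; exact: is_derive_flat.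
have cf j x : U x -> {for x, continuous (fun z => flat j (u z))}.
  move=> Ux; apply: (@continuous_comp _ _ _ u (flat j)).
    exact: smooth_on_continuous hu Ux.
  apply: differentiable_continuous; apply/derivable1_diffP.
  by have [] := is_derive_flat j (u x).
elim: k l => [|k IH] l; (split; first by move=> x; exact: cf) => // a.
split=> [x /h|]; first by move=> /(_ l a)/is_pderiv_derivable.
apply: (@Ck_on_eq _ _ _ _ (fun x => (flat l.+2 (u x) + (- l%:R) * flat l.+1 (u x))
   * pderiv a u x)) => //.
  by move=> x Ux; rewrite (is_pderiv_val (h l x a Ux)) mulNr.
apply: Ck_onM => //; last exact: (smooth_on_pderiv a hu k).
by apply: Ck_onD => //; apply: Ck_onM => //; exact: Ck_on_cst.
Qed.

End FlatComp.

(** * Sections of the tractor bundle with a prescribed value *)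

Section Manifold.
Context (R : realType) (n : nat) (M : complexManifold R n).
Implicit Types (i j k : mindex M) (x y z : 'rV[R]_(n + n)).

Lemma chart_img_inv i x : chart_img i x -> mdom i (mchart_inv i x).
Proof. by move=> [p dp <-]; rewrite mchartK. Qed.

Lemma chart_imgK i x : chart_img i x -> mchart i (mchart_inv i x) = x.
Proof. by move=> [p dp <-]; rewrite mchartK. Qed.

Lemma overlapP i j x : overlap i j x <->
  chart_img i x /\ mdom j (mchart_inv i x).
Proof.
split=> [[p [dp dp'] <-]|[[p dp <-]]].
  by rewrite mchartK //; split => //; exists p.
by rewrite mchartK // => dp'; exists p.
Qed.

Lemma chart_img_open i : open (chart_img i).
Proof. exact: mimg_open. Qed.

Lemma inv_preimage_open i (A : set M) : open A ->
  open [set x | chart_img i x /\ A (mchart_inv i x)].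
Proof.
move=> oA; rewrite openE => x [ix Ax].
have n1 : nbhs x (chart_img i) by apply: open_nbhs_nbhs; split => //; exact: chart_img_open.
have n2 : nbhs x (mchart_inv i @^-1` A).
  by apply: (mchart_inv_continuous ix); exact: open_nbhs_nbhs.
exact: filterI n1 n2.
Qed.

Lemma overlap_open i j : open (overlap i j).
Proof.
have -> : overlap i j = [set x | chart_img i x /\ mdom j (mchart_inv i x)].
  by apply/seteqP; split => x /overlapP.
exact: inv_preimage_open (mdom_open j).
Qed.

Lemma transition_inv i j x : overlap i j x ->
  mchart_inv j (transition i j x) = mchart_inv i x.
Proof. by move=> /overlapP[_ dj]; rewrite /transition mchartK. Qed.

Lemma transition_overlap i j x : overlap i j x -> overlap j i (transition i j x).
Proof.
move=> h; apply/overlapP; rewrite transition_inv //.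
have [ix dj] := (overlapP _ _ _).1 h; split; last exact: chart_img_inv.
by exists (mchart_inv i x).
Qed.

Lemma transition_comp i j k x : overlap i j x ->
  transition j k (transition i j x) = transition i k x.
Proof. by move=> h; rewrite {1}/transition transition_inv. Qed.

Lemma transition_id i x : chart_img i x -> transition i i x = x.
Proof. exact: chart_imgK. Qed.

Lemma transition_smooth i j b :
  smooth_on (overlap i j) (fun x => transition i j x 0 b).
Proof. exact: mtransition_smooth. Qed.

Lemma jacE (T : 'rV[R]_(n + n) -> 'rV[R]_(n + n)) x a b :
  jac T x a b = pderiv a (fun z => T z 0 b) x.
Proof. by rewrite mxE. Qed.

Lemma jac_transition_id i x : chart_img i x -> jac (transition i i) x = 1%:M.
Proof.
move=> ix; apply/matrixP => a b; rewrite jacE [RHS]mxE.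
apply: is_pderiv_val.
have E z : chart_img i z -> z 0 b = transition i i z 0 b by move=> iz; rewrite transition_id.
exact: (is_pderiv_open (chart_img_open (i := i)) ix E (is_pderiv_coord a b x)).
Qed.

Lemma jac_cocycle i j k x : overlap i j x -> overlap i k x ->
  jac (transition i k) x =
  jac (transition i j) x *m jac (transition j k) (transition i j x).
Proof.
move=> ij ik; apply/matrixP => a b; rewrite jacE [RHS]mxE.
have jk : overlap j k (transition i j x).
  apply/overlapP; rewrite transition_inv //; split; last by have [] := (overlapP _ _ _).1 ik.
  by have [] := (overlapP _ _ _).1 (transition_overlap ij).
have H := pderiv_comp a (overlap_open (i := i) (j := j)) (overlap_open (i := j) (j := k)) ij jk
  (fun c => transition_smooth i j c 1%N) (transition_smooth j k b 1%N).
rewrite (eq_bigr (fun c => pderiv a (fun z => transition i j z 0 c) x *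
  pderiv c (fun z => transition j k z 0 b) (transition i j x))); last first.
  by move=> c _; rewrite !jacE.
apply: is_pderiv_val; apply: is_pderiv_open (overlap_open (i := i) (j := j)) ij _ H.
by move=> z hz; rewrite transition_comp.
Qed.

(** * A bump section supported in one chart *)

Section BumpSection.
Context (i0 : mindex M) (x0 : 'rV[R]_(n + n)) (i0x0 : chart_img i0 x0).
Context (e : R) (e_gt0 : 0 < e).

Definition box : set 'rV[R]_(n + n) :=
  [set v | forall b, `[x0 0 b - e, x0 0 b + e]%classic (v 0 b)].

Hypothesis box_sub : box `<=` chart_img i0.

(** A polynomial in the coordinates, positive exactly on the open Euclidean ball of radius [e],
    which lies in the box. *)
Definition bump_arg z : R := e ^+ 2 - \sum_b (z 0 b - x0 0 b) ^+ 2.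
Definition bump z : R := flat 0 (bump_arg z).

Lemma bump_center : 0 < bump x0.
Proof.
apply: flat_gt0; rewrite /bump_arg big1 => [|b _]; last by rewrite subrr expr0n.
by rewrite subr0 exprn_gt0.
Qed.

Lemma bump_box z : bump z != 0 -> box z.
Proof.
move=> bz b; have : 0 < bump_arg z.
  by rewrite ltNge; apply: contra bz => h; rewrite /bump flat_le0.
rewrite /bump_arg subr_gt0 (bigD1 b) //= => h.
have {}h : (z 0 b - x0 0 b) ^+ 2 < e ^+ 2.
  by apply: le_lt_trans h; rewrite lerDl sumr_ge0 // => c _; exact: sqr_ge0.
rewrite /= in_itv /=; set t := z 0 b; set s := x0 0 b.
have : `|t - s| < e.
  by rewrite -[e]ger0_norm ?(ltW e_gt0) // -ltr_sqr ?nnegrE // -!normrX !ger0_norm ?sqr_ge0.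
by rewrite ltr_norml => /andP[h1 h2]; apply/andP; split; lra.
Qed.

Definition support : set M := mchart_inv i0 @` box.

(** The box is a product of segments, hence compact, and so is its image in the Hausdorff space [M].
    The complement is then an open set on which the extension by zero is smooth. *)
Lemma support_closed : closed support.
Proof.
apply: compact_closed; first exact: mhausdorff.
apply: continuous_compact.
  apply: continuous_in_subspaceT => z /set_mem bz.
  exact: mchart_inv_continuous (box_sub bz).
exact: (@rV_compact R (n + n) (fun b => `[x0 0 b - e, x0 0 b + e]%classic)
  (fun b => @segment_compact R _ _)).
Qed.

Context (v : tractor R (n + n)).

(** In the chart [i0] this is the bump times the constant tractor [v]; in another chart [j] it is
    the pullback of that section, by the rule of [tractor_pull]. *)
Definition bump_section j y : tractor R (n + n) :=
  if `[< mdom i0 (mchart_inv j y) >] then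
    (bump (transition j i0 y) * v.1.1,
     bump (transition j i0 y) *: (v.1.2 *m (jac (transition j i0) y)^T),
     bump (transition j i0 y) * v.2)
  else 0.

Lemma bump_section_in j y : overlap j i0 y -> bump_section j y =
    (bump (transition j i0 y) * v.1.1,
     bump (transition j i0 y) *: (v.1.2 *m (jac (transition j i0) y)^T),
     bump (transition j i0 y) * v.2).
Proof. by move=> /overlapP[_ d]; rewrite /bump_section asboolT. Qed.

Definition off_support j : set 'rV[R]_(n + n) :=
  [set y | chart_img j y /\ (~` support) (mchart_inv j y)].

Lemma bump_section_out j y : off_support j y -> bump_section j y = 0.
Proof.
move=> [jy sy]; rewrite /bump_section; case: asboolP => // d.
suff -> : bump (transition j i0 y) = 0 by rewrite !mul0r scale0r.
apply/eqP; apply/negPn/negP => /bump_box h; apply: sy.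
exists (transition j i0 y) => //; apply: transition_inv; exact/overlapP.
Qed.

Lemma bump_section_cover j y : chart_img j y -> overlap j i0 y \/ off_support j y.
Proof.
move=> jy; have [d|d] := pselect (mdom i0 (mchart_inv j y)).
  by left; apply/overlapP.
right; split => //= -[z bz E]; apply: d; rewrite -E.
exact: chart_img_inv (box_sub bz).
Qed.

(** [c] stands for a component of the tractor, and [c 0 = 0] makes it vanish off the support. The
    overlap with [i0] and the complement of the support are open and cover the chart, so smoothness
    can be checked on each. *)
Lemma smooth_bump_section j (c : tractor R (n + n) -> R) :
  c 0 = 0 ->
  smooth_on (overlap j i0) (fun y => c
    (bump (transition j i0 y) * v.1.1,
     bump (transition j i0 y) *: (v.1.2 *m (jac (transition j i0) y)^T),
     bump (transition j i0 y) * v.2)) ->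
  smooth_on (chart_img j) (fun y => c (bump_section j y)).
Proof.
move=> c0 h k; apply: Ck_on_local => y /bump_section_cover[oy|oy].
  exists (overlap j i0) => //; apply: Ck_on_eq (h k); first exact: overlap_open.
  by move=> z oz; rewrite bump_section_in.
exists (off_support j) => //; apply: Ck_on_eq (Ck_on_cst k _ 0).
  by apply: inv_preimage_open; rewrite openC; exact: support_closed.
by move=> z oz; rewrite bump_section_out.
Qed.

Lemma smooth_bump_transition j :
  smooth_on (overlap j i0) (fun y => bump (transition j i0 y)).
Proof.
move=> k; have oU := @overlap_open j i0.
apply: (@Ck_on_flat R _ _ (fun y => bump_arg (transition j i0 y))) => // l.
apply: Ck_onD => //; first exact: Ck_on_cst.
apply: Ck_onN => //; apply: Ck_on_sum => // b _.
have h : Ck_on l (overlap j i0) (fun y => transition j i0 y 0 b - x0 0 b).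
  apply: Ck_onD => //; [exact: transition_smooth|exact: Ck_on_cst].
exact: Ck_onM.
Qed.

Lemma bump_section_smooth j : tractor_smooth_on (chart_img j) (bump_section j).
Proof.
have oU := @overlap_open j i0.
split.
- apply: (@smooth_bump_section j (fun t => t.1.1)) => // k.
  by apply: Ck_onM => //; [exact: smooth_bump_transition|exact: Ck_on_cst].
- move=> b; apply: (@smooth_bump_section j (fun t => t.1.2 0 b)); first by rewrite mxE.
  move=> k.
  apply: (@Ck_on_eq _ _ _ _ (fun y => bump (transition j i0 y) *
    \sum_a v.1.2 0 a * pderiv b (fun z => transition j i0 z 0 a) y)) => //.
    move=> y _ /=; rewrite mxE; congr (_ * _); rewrite mxE; apply: eq_bigr => a _.
    by rewrite mxE jacE.
  apply: Ck_onM => //; first exact: smooth_bump_transition.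
  apply: Ck_on_sum => // a _; apply: Ck_onM => //; first exact: Ck_on_cst.
  exact: smooth_on_pderiv (@transition_smooth j i0 a) k.
- apply: (@smooth_bump_section j (fun t => t.2)) => // k.
  by apply: Ck_onM => //; [exact: smooth_bump_transition|exact: Ck_on_cst].
Qed.

Lemma bump_section_compat i j x : overlap i j x ->
  bump_section i x = tractor_pull (jac (transition i j) x)
                 (bump_section j (transition i j x)).
Proof.
move=> ij; rewrite /bump_section transition_inv //.
case: asboolP => [d|_]; last by rewrite /tractor_pull mul0mx.
have ii0 : overlap i i0 x by apply/overlapP; split => //; have [] := (overlapP _ _ _).1 ij.
rewrite /tractor_pull /= transition_comp // (jac_cocycle ij ii0).
by rewrite trmx_mul mulmxA -scalemxAl.
Qed.

Definition bump_tractorSection : tractorSection M :=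
  TractorSection bump_section_smooth bump_section_compat.

Lemma bump_tractorSection_center : bump_tractorSection i0 x0 =
  (bump x0 * v.1.1, bump x0 *: v.1.2, bump x0 * v.2).
Proof.
rewrite /= bump_section_in; last by apply/overlapP; split => //; exact: chart_img_inv.
by rewrite transition_id // jac_transition_id // trmx1 mulmx1.
Qed.

Lemma bump_tractorSection_sigma0 j y : v.1.1 = 0 ->
  (bump_tractorSection j y).1.1 = 0.
Proof.
by move=> v0; rewrite /= /bump_section; case: ifP => //= _; rewrite v0 mulr0.
Qed.

End BumpSection.

(** The second clause is about the whole manifold: when sigma is prescribed to be 0 at the point,
    the derivatives of sigma vanish as well. *)
Lemma tractorSection_through i0 x0 (v : tractor R (n + n)) : chart_img i0 x0 ->
  exists Sig : tractorSection M, Sig i0 x0 = v /\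
    (v.1.1 = 0 -> forall j y, (Sig j y).1.1 = 0).
Proof.
move=> ix.
have nb : nbhs x0 (chart_img i0).
  by apply: open_nbhs_nbhs; split => //; exact: chart_img_open.
have [e /= e0 he] := (nbhs_ballP _ _).1 nb.
(* Half the radius keeps the closed box inside the open ball. *)
have e2 : 0 < e / 2 by rewrite divr_gt0.
have bs : box x0 (e / 2) `<=` chart_img i0.
  move=> z bz; apply: he; rewrite -ball_normE /= distrC.
  apply: (@le_lt_trans _ _ (e / 2)); last by lra.
  rewrite [leLHS]/Num.Def.normr /= mx_normrE.
  apply: bigmax_le => [|[a b] _ /=]; first exact: ltW.
  rewrite (ord1 a) !mxE ler_norml; have := bz b; rewrite /= in_itv /=.
  by move: (z 0 b) (x0 0 b) => s t /andP[h1 h2]; apply/andP; split; lra.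
have b0 := bump_center x0 e2.
(* Cancels the value of the bump at its centre. *)
pose c := (bump x0 (e / 2) x0)^-1.
exists (bump_tractorSection e2 bs (c * v.1.1, c *: v.1.2, c * v.2)); split.
  rewrite bump_tractorSection_center //= !mulrA scalerA /c mulfV ?gt_eqF //.
  by rewrite !mul1r scale1r; case: v => -[].
by move=> v0 j y; apply: bump_tractorSection_sigma0; rewrite /= v0 mulr0.
Qed.

End Manifold.

(** * Linear algebra of the curvature *)

Section StandardJ.
Context (R : realType) (n : nat).
Local Notation J0 := (std_J R n).

Lemma std_J_sqr : J0 *m J0 = - 1%:M.
Proof.
rewrite /std_J mulmx_block !mul0mx !mulmx0 !mulmxN !mulNmx !mulmx1 !add0r !addr0.
by rewrite [X in _ = - X]scalar_mx_block opp_block_mx oppr0.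
Qed.

Lemma std_J_tr : J0^T = - J0.
Proof.
by rewrite /std_J tr_block_mx !linear0 linearN /= tr_scalar_mx opp_block_mx !oppr0 opprK.
Qed.

Lemma std_JK (k : nat) (A : 'M[R]_(n + n, k)) : J0 *m (J0 *m A) = - A.
Proof. by rewrite mulmxA std_J_sqr mulNmx mul1mx. Qed.

Lemma std_JKr (k : nat) (A : 'M[R]_(k, n + n)) : A *m J0 *m J0 = - A.
Proof. by rewrite -mulmxA std_J_sqr mulmxN mulmx1. Qed.

Lemma std_J_trace : \tr J0 = 0.
Proof. by rewrite /std_J mxtrace_block !linear0 addr0. Qed.

Section Metric.
Context (G : 'M[R]_(n + n)).
Hypotheses (Gsym : G^T = G) (Gunit : G \in unitmx) (GJ : J0 *m G = G *m J0).
Local Notation H := (invmx G).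
Local Notation J := (J0 *m G).

Lemma invmx_sym : H^T = H.
Proof. by rewrite trmx_inv Gsym. Qed.

Lemma invmx_std_J : J0 *m H = H *m J0.
Proof.
by rewrite -[LHS](mulKmx Gunit) (mulmxA G) -GJ -(mulmxA J0) (mulmxV Gunit) mulmx1.
Qed.

Lemma kahler_skew : J^T = - J.
Proof. by rewrite trmx_mul Gsym std_J_tr mulmxN -GJ. Qed.

Lemma kahler_tr_mul : J^T *m (H *m J0) = 1%:M.
Proof.
rewrite kahler_skew mulNmx (mulmxA J) -(mulmxA J0 G) (mulmxV Gunit) mulmx1.
by rewrite std_J_sqr opprK.
Qed.

Lemma kahler_inv : invmx J^T = H *m J0.
Proof.
have uJ : J^T \in unitmx by have [] := mulmx1_unit kahler_tr_mul.
by rewrite -[LHS]mulmx1 -kahler_tr_mul mulKmx.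
Qed.

Lemma skew_contract0 (A B : 'M[R]_(n + n)) : A^T = A -> B^T = - B ->
  \sum_b \sum_c A b c * B b c = 0.
Proof.
move=> As Bs; set s := \sum_b _; suff e : s = - s.
  by move: s e => s e; lra.
rewrite /s [in RHS]exchange_big /= -sumrN; apply: eq_bigr => b _.
rewrite -sumrN; apply: eq_bigr => c _.
move/matrixP/(_ b c) : As; move/matrixP/(_ b c) : Bs; rewrite !mxE => -> <-.
by rewrite mulrN opprK.
Qed.

(** This and the next lemmas convert index contractions into matrix products, so that traces of
    tensor identities can be evaluated by matrix algebra. *)
Lemma contract_lr (K A B : 'M[R]_(n + n)) a f :
  \sum_b \sum_c K b c * (A a b * B c f) = (A *m K *m B) a f.
Proof.
rewrite exchange_big mxE; apply: eq_bigr => c _.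
rewrite mxE big_distrl; apply: eq_bigr => b _ /=.
by rewrite mulrA [K b c * _]mulrC.
Qed.

Lemma contract_rl (K A B : 'M[R]_(n + n)) a f :
  \sum_b \sum_c K b c * (A a c * B b f) = (A *m K^T *m B) a f.
Proof.
rewrite exchange_big /= -contract_lr; apply: eq_bigr => c _.
by apply: eq_bigr => b _; rewrite !mxE.
Qed.

Lemma contract_cst (K A : 'M[R]_(n + n)) k :
  \sum_b \sum_c K b c * (A b c * k) = (\sum_b \sum_c K b c * A b c) * k.
Proof.
rewrite big_distrl; apply: eq_bigr => b _; rewrite big_distrl.
by apply: eq_bigr => c _; rewrite mulrA.
Qed.

Lemma contract_cstl (K A : 'M[R]_(n + n)) k :
  \sum_b \sum_c K b c * (k * A b c) = (\sum_b \sum_c K b c * A b c) * k.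
Proof.
by rewrite -contract_cst; apply: eq_bigr => b _; apply: eq_bigr => c _; rewrite [k * _]mulrC.
Qed.

Lemma contract_inv : \sum_b \sum_c H b c * G b c = (n + n)%:R.
Proof.
rewrite -(mxtrace1 R) -(mulVmx Gunit) /mxtrace; apply: eq_bigr => b _.
rewrite mxE; apply: eq_bigr => c _; congr (_ * _).
by move/matrixP/(_ b c) : Gsym; rewrite mxE.
Qed.

Lemma sum2D (X Y : 'I_(n + n) -> 'I_(n + n) -> R) :
  \sum_b \sum_c (X b c + Y b c) = \sum_b \sum_c X b c + \sum_b \sum_c Y b c.
Proof. by rewrite -big_split; apply: eq_bigr => b _; rewrite -big_split. Qed.

Lemma sum2N (X : 'I_(n + n) -> 'I_(n + n) -> R) :
  \sum_b \sum_c - X b c = - \sum_b \sum_c X b c.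
Proof. by rewrite -sumrN; apply: eq_bigr => b _; rewrite -sumrN. Qed.

Lemma sum2Z k (X : 'I_(n + n) -> 'I_(n + n) -> R) :
  \sum_b \sum_c k * X b c = k * \sum_b \sum_c X b c.
Proof. by rewrite mulr_sumr; apply: eq_bigr => b _; rewrite mulr_sumr. Qed.

(** * The mu-part of flatness at a point *)

Section Einstein.
Context (P mu_Theta : 'M[R]_(n + n)) (Rm : 'I_(n + n) -> 'I_(n + n) -> 'M[R]_(n + n)).
Local Notation Psi := (P *m (H *m J0)).
Hypotheses (n_gt0 : (0 < n)%N) (Psym : P^T = P) (PJ : J0 *m P = P *m J0)
  (Rskew : forall a b, (G *m Rm a b)^T = - (G *m Rm a b))
  (Ric : forall b d, \sum_a Rm a b a d = (2 * n.+1)%:R * P b d)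
  (flat_eq : forall a b e c, Rm a b e c + P a c * (b == e)%:R
     - P b c * (a == e)%:R + J a c * Psi b e - J b c * Psi a e
     = - (2 * J a b * mu_Theta c e)).

Lemma flat_Einstein : exists L : R, P = L *: G /\ mu_Theta = L *: J0.
Proof.
have PsiG : Psi *m G = P *m J0.
  by rewrite -mulmxA -(mulmxA H) GJ mulKmx.
have low a b f c : (G *m Rm a b) f c = P b c * G a f - P a c * G b f
    + J b c * (P *m J0) a f - J a c * (P *m J0) b f - 2 * J a b * (mu_Theta *m G) c f.
  have Gs x y : G x y = G y x by move/matrixP/(_ y x) : Gsym; rewrite mxE.
  rewrite -PsiG !(mxE _ _ f c) !(mxE _ _ _ f).
  have -> : G a f = \sum_e (a == e)%:R * G e f.
    by rewrite (bigD1 a) //= eqxx mul1r big1 ?addr0 // => e /negPf ea; rewrite eq_sym ea mul0r.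
  have -> : G b f = \sum_e (b == e)%:R * G e f.
    by rewrite (bigD1 b) //= eqxx mul1r big1 ?addr0 // => e /negPf ea; rewrite eq_sym ea mul0r.
  transitivity (\sum_e (P b c * ((a == e)%:R * G e f)
    - P a c * ((b == e)%:R * G e f) + J b c * (Psi a e * G e f)
    - J a c * (Psi b e * G e f) - 2 * J a b * (mu_Theta c e * G e f))); last first.
    by rewrite !big_split /= !sumrN -!mulr_sumr.
  apply: eq_bigr => e _.
  rewrite (Gs f e); have := flat_eq a b e c; move: (Rm a b e c) => r Hr.
  have -> : r = P b c * (a == e)%:R - P a c * (b == e)%:R + J b c * Psi a e
     - J a c * Psi b e - 2 * J a b * mu_Theta c e.
    by move: Hr; move: (J a c) (J b c) (J a b) (Psi b e) (Psi a e) => *; lra.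
  by ring.
(* [low] symmetrised over f and c, then traced over b and c. *)
pose t := \sum_b \sum_c H b c * P b c.
pose S := mu_Theta *m G + (mu_Theta *m G)^T.
have QT : (P *m J0)^T = - (P *m J0) by rewrite trmx_mul Psym std_J_tr mulNmx PJ.
have cP : J *m H *m (P *m J0) = - P.
  by rewrite -(mulmxA J0) (mulmxV Gunit) mulmx1 mulmxA PJ std_JKr.
have cP' : P *m J0 *m H *m J = - P.
  rewrite -!mulmxA (mulmxA J0 H) invmx_std_J -(mulmxA H) std_JK mulmxN.
  by rewrite (mulVmx Gunit) mulmxN mulmx1.
have main a f : t * G a f - (n + n)%:R * P a f - 2 * (J0 *m S) a f = 0.
  transitivity (\sum_b \sum_c H b c * ((G *m Rm a b) f c + (G *m Rm a b) c f)).
    under eq_bigr do under eq_bigr do rewrite !low.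
    transitivity (\sum_b \sum_c (H b c * (P b c * G a f) - H b c * (P a c * G b f)
      + H b c * (J b c * (P *m J0) a f) - H b c * (J a c * (P *m J0) b f)
      + (-2) * (H b c * (J a b * (mu_Theta *m G) c f))
      + H b c * (G a c * P b f) - H b c * (P a f * G b c)
      + H b c * ((P *m J0) a c * J b f) - H b c * (J a f * (P *m J0) b c)
      + (-2) * (H b c * (J a b * (mu_Theta *m G)^T c f)))); last first.
      apply: eq_bigr => b _; apply: eq_bigr => c _.
      have -> : (mu_Theta *m G)^T c f = (mu_Theta *m G) f c by rewrite mxE.
      move: (J a c) (J b c) (J a b) (J b f) (J a f) => ? ? ? ? ?.
      by move: ((P *m J0) a f) ((P *m J0) a c) ((P *m J0) b c) ((P *m J0) b f) => *; ring.
    rewrite !sum2D !sum2N !sum2Z !contract_cst !contract_cstl !contract_rl !contract_lr.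
    rewrite !invmx_sym contract_inv.
    rewrite (skew_contract0 invmx_sym kahler_skew) (skew_contract0 invmx_sym QT).
    rewrite cP cP' -!(mulmxA _ H G) (mulVmx Gunit) -(mulmxA G H) (mulmxA G H) (mulmxV Gunit).
    rewrite mulmx1 mul1mx -(mulmxA J0 G H) (mulmxV Gunit) mulmx1 /S mulmxDr.
    rewrite -/t !mxE; move: ((J0 *m (mu_Theta *m G)) a f) ((J0 *m (mu_Theta *m G)^T) a f) => x y.
    by move: (n + n)%:R => N; ring.
  apply: big1 => b _; apply: big1 => c _.
  have /matrixP/(_ f c) := Rskew a b; rewrite [LHS]mxE [RHS]mxE => ->.
  by rewrite subrr mulr0.
have Ssym : S^T = S by rewrite /S linearD /= trmxK addrC.
have N0 : (n + n)%:R != 0 :> R by rewrite pnatr_eq0 addn_eq0 andbb -lt0n.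
have mainM : t *: G - (n + n)%:R *: P = 2 *: (J0 *m S).
  by apply/matrixP => a f; move: (main a f); rewrite !mxE => ?; lra.
have JSs : (J0 *m S)^T = J0 *m S.
  have /(canRL (scalerK _)) -> : 2 *: (J0 *m S) = t *: G - (n + n)%:R *: P by [].
    by rewrite linearZ /= linearB /= !linearZ /= Gsym Psym.
  by rewrite pnatr_eq0.
have JSc : J0 *m (J0 *m S) = (J0 *m S) *m J0.
  have /(canRL (scalerK _)) -> : 2 *: (J0 *m S) = t *: G - (n + n)%:R *: P by [].
    by rewrite -scalemxAr -scalemxAl mulmxBr mulmxBl -!scalemxAr -!scalemxAl GJ PJ.
  by rewrite pnatr_eq0.
(* [S] is symmetric, so the symmetry of J S says that S anticommutes with J, whereas [JSc] says that
   they commute. Hence S = - S. *)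
have S0 : S = 0.
  move: JSs; rewrite trmx_mul Ssym std_J_tr mulmxN => E.
  move: JSc; rewrite -E mulNmx std_JKr opprK mulmxN mulmxA -E mulNmx std_JKr opprK.
  by move=> e; apply/matrixP => a b; move/matrixP/(_ a b): e; rewrite !mxE => ?; lra.
pose L := t / (n + n)%:R.
have PL : P = L *: G.
  apply/matrixP => a f; move: (main a f); rewrite S0 mulmx0 !mxE mulr0 subr0 /L => e.
  by rewrite mulrAC; apply: (mulIf N0); rewrite mulfVK // mulrC; move: ((n + n)%:R * P a f) e => *; lra.
exists L; split => //.
have PsiJ : Psi = L *: J0.
  by rewrite PL -scalemxAl (mulKVmx Gunit).
(* The trace over a = e of [flat_eq]: the coefficients 2(n+1) + 1 - 2n - 1 of [P] sum to 2, which is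
   matched by -2 times the product of [mu_Theta] and J. *)
have Thj : mu_Theta *m J = - (L *: G).
  apply/matrixP => c b.
  transitivity (- P b c); last by rewrite PL !mxE; move/matrixP/(_ b c): Gsym; rewrite mxE => ->.
  have e1 : \sum_a (Rm a b a c + P a c * (b == a)%:R - P b c * (a == a)%:R
     + J a c * Psi b a - J b c * Psi a a) = \sum_a - (2 * J a b * mu_Theta c a).
    by apply: eq_bigr => a _; exact: flat_eq.
  move: e1; rewrite !big_split /= !sumrN Ric.
  have -> : \sum_a P a c * (b == a)%:R = P b c.
    rewrite (bigD1 b) //= eqxx mulr1 big1 ?addr0 // => e /negPf eb.
    by rewrite eq_sym eb mulr0.
  have -> : \sum_(a < n + n) P b c * (a == a)%:R = (n + n)%:R * P b c.
    rewrite (eq_bigr (fun=> P b c)) => [|a _]; last by rewrite eqxx mulr1.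
    by rewrite sumr_const card_ord mulr_natl.
  have -> : \sum_a J a c * Psi b a = - P b c.
    transitivity ((Psi *m J) b c).
      by rewrite mxE; apply: eq_bigr => a _; rewrite [J a c * _]mulrC.
    by rewrite PsiJ -scalemxAl std_JK PL scalerN mxE.
  have -> : \sum_a J b c * Psi a a = 0.
    rewrite -mulr_sumr (_ : \sum_a Psi a a = \tr Psi) // PsiJ linearZ /= std_J_trace.
    by rewrite !mulr0.
  have -> : \sum_a 2 * J a b * mu_Theta c a = 2 * (mu_Theta *m J) c b.
    rewrite [in RHS]mxE mulr_sumr; apply: eq_bigr => a _.
    by rewrite -mulrA [J a b * _]mulrC.
  move: ((mu_Theta *m J) c b) (P b c) => x y.
  have -> : (2 * n.+1)%:R = (n + n)%:R + 2 :> R.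
    by rewrite mulnS mul2n -addnn natrD addrC.
  by move: (n + n)%:R => N; lra.
have : mu_Theta *m J *m H *m J0 = - (L *: J0).
  by rewrite Thj mulNmx -scalemxAl (mulmxV Gunit) mulNmx -scalemxAl mul1mx.
rewrite -(mulmxA mu_Theta) -(mulmxA J0) (mulmxV Gunit) mulmx1 std_JKr => /oppr_inj.
by [].
Qed.

End Einstein.

(** * The sigma-part of flatness at a point *)

Section ParallelScale.
Context (l t : 'cV[R]_(n + n)) (k : R).
Hypotheses (n_gt1 : (1 < n)%N) (kE : k = (2 * n + 1)%:R^-1)
  (grad_eq : forall a b c, l a 0 * G b c - l b 0 * G a c
     + J a c * (k *: (J0 *m l)) b 0 - J b c * (k *: (J0 *m l)) a 0
     = 2 * J a b * t c 0).

(** Here [l] is the gradient of the scalar L, [k *: (J0 *m l)] is the covector S_a, and [t] is the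
    unknown mu-part of Theta (1, 0, 0). Two contractions give two linear relations between [l] and
    [J0 *m t], from which [t] is eliminated. *)
Lemma parallel_scale : l = 0.
Proof.
pose s := k *: (J0 *m l).
have Gs x y : G x y = G y x by move/matrixP/(_ y x) : Gsym; rewrite mxE.
have Hs x y : H x y = H y x by move/matrixP/(_ y x) : invmx_sym; rewrite mxE.
pose I := H *m J0.
have Is x y : I x y = - I y x.
  have : I^T = - I by rewrite /I trmx_mul invmx_sym std_J_tr mulNmx invmx_std_J.
  by move/matrixP/(_ y x); rewrite !mxE.
have colE (A : 'M[R]_(n + n)) (K : 'M[R]_(n + n)) (v : 'cV[R]_(n + n)) a :
    \sum_b \sum_c K b c * (A a c * v b 0) = (A *m K^T *m v) a 0.
  rewrite mxE; apply: eq_bigr => b _; rewrite mxE big_distrl; apply: eq_bigr => c _ /=.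
  by rewrite mxE mulrA [K b c * _]mulrC.
have colE2 (A : 'M[R]_(n + n)) (K : 'M[R]_(n + n)) (v : 'cV[R]_(n + n)) a :
    \sum_b \sum_c K b c * (A a b * v c 0) = (A *m K *m v) a 0.
  rewrite exchange_big mxE; apply: eq_bigr => b _; rewrite mxE big_distrl; apply: eq_bigr => c _ /=.
  by rewrite mulrA [K c b * _]mulrC.
(* The trace of [grad_eq] over b and c. *)
have eq1 : ((n + n)%:R - 1 - k) *: l = 2 *: (J0 *m t).
  apply/colP => a.
  have : \sum_b \sum_c H b c * (l a 0 * G b c - l b 0 * G a c
     + J a c * s b 0 - J b c * s a 0) = \sum_b \sum_c H b c * (2 * J a b * t c 0).
    by apply: eq_bigr => b _; apply: eq_bigr => c _; rewrite grad_eq.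
  rewrite (_ : \sum_b _ = \sum_b \sum_c (H b c * (l a 0 * G b c)
     - H b c * (G a c * l b 0) + H b c * (J a c * s b 0) - H b c * (J b c * s a 0)));
    last first.
    apply: eq_bigr => b _; apply: eq_bigr => c _.
    by move: (J a c) (J b c) (s a 0) (s b 0) => *; ring.
  rewrite (_ : \sum_b \sum_c H b c * (2 * J a b * t c 0) =
     \sum_b \sum_c 2 * (H b c * (J a b * t c 0))); last first.
    by apply: eq_bigr => b _; apply: eq_bigr => c _; rewrite -mulrA mulrCA.
  rewrite !sum2D !sum2N !sum2Z contract_cstl contract_inv !colE colE2 contract_cst.
  rewrite (skew_contract0 invmx_sym kahler_skew) mul0r subr0 invmx_sym (mulmxV Gunit) mul1mx.
  rewrite -(mulmxA J0) (mulmxV Gunit) mulmx1 /s -scalemxAr std_JK !mxE => e.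
  by move: e; move: (\sum_j _) (n + n)%:R => x N; lra.
(* The contraction of [grad_eq] with J^ab. *)
have eq2 : (- 2 + 2 * k) *: (J0 *m l) = (2 * (n + n)%:R) *: t.
  apply/colP => c.
  have : \sum_a \sum_b I a b * (l a 0 * G b c - l b 0 * G a c
     + J a c * s b 0 - J b c * s a 0) = \sum_a \sum_b I a b * (2 * J a b * t c 0).
    by apply: eq_bigr => a _; apply: eq_bigr => b _; rewrite grad_eq.
  rewrite (_ : \sum_a _ = \sum_a \sum_b (I a b * (G c b * l a 0)
     - I a b * (G c a * l b 0) + I a b * (J^T c a * s b 0) - I a b * (J^T c b * s a 0)));
    last first.
    apply: eq_bigr => a _; apply: eq_bigr => b _.
    rewrite (Gs c b) (Gs c a) !(mxE _ _ c).
    by move: (J a c) (J b c) (s a 0) (s b 0) => *; ring.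
  rewrite (_ : \sum_a \sum_b I a b * (2 * J a b * t c 0) =
     \sum_a \sum_b (2 * t c 0) * (I a b * J a b)); last first.
    apply: eq_bigr => a _; apply: eq_bigr => b _.
    by move: (J a b) => *; ring.
  rewrite !sum2D !sum2N !sum2Z !colE !colE2.
  have IT : I^T = - I by apply/matrixP => x y; rewrite [LHS]mxE Is [RHS]mxE.
  have JI : J^T *m I = 1%:M by exact: kahler_tr_mul.
  have -> : \sum_a \sum_b I a b * J a b = (n + n)%:R.
    rewrite -(mxtrace1 R) -JI /mxtrace exchange_big; apply: eq_bigr => b _.
    by rewrite [RHS]mxE; apply: eq_bigr => a _; rewrite [in RHS]mxE mulrC.
  rewrite IT !mulmxN JI !mulNmx mul1mx.
  have -> : G *m I = J0 by rewrite /I mulKVmx.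
  rewrite !mxE => e.
  by move: e; move: (\sum_j _) (n + n)%:R => x N; lra.
apply/colP => a; rewrite [RHS]mxE.
move/(congr1 (fun v => J0 *m v)) : eq2; rewrite -!scalemxAr std_JK.
move: (J0 *m t) eq1 => y eq1 eq2.
move/matrixP/(_ a 0) : eq1; move/matrixP/(_ a 0) : eq2; rewrite !(mxE _ _ a).
move: (y a 0) (l a 0) => {}y x.
have k0 : (2 * n + 1)%:R != 0 :> R by rewrite pnatr_eq0 addn1.
have kk : k * (2 * n%:R + 1) = 1.
  by rewrite kE -[2 * _ + 1]/(2%:R * n%:R + 1%:R) -natrM -natrD mulVf.
have n2 : 2 <= n%:R :> R by rewrite ler_nat.
rewrite natrD; move: (n%:R) n2 kk => N n2 kk e1 e2.
(* [A] and [B] are the two relations and [C] is the definition of [k]. The combination below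
   eliminates first [y] and then [k]; its value is nonzero times [x] precisely because N >= 2. *)
have e3 : x * (8 * N * (N ^+ 2 - 1)) = 0.
  pose A := (- 2 + 2 * k) * (- x) - 2 * (N + N) * y.
  pose B := (N + N - 1 - k) * x - 2 * y.
  pose C := k * (2 * N + 1) - 1.
  have A0 : A = 0 by rewrite /A e1 subrr.
  have B0 : B = 0 by rewrite /B e2 subrr.
  have C0 : C = 0 by rewrite /C kk subrr.
  transitivity ((2 * N + 1) * (2 * N * B - A) - (2 - 2 * N) * C * x).
    by rewrite /A /B /C; ring.
  by rewrite A0 B0 C0; ring.
have N1 : 8 * N * (N ^+ 2 - 1) != 0.
  apply: lt0r_neq0; apply: mulr_gt0; first by lra.
  by rewrite subr_gt0 expr2; nra.
by apply/eqP; rewrite -(mulIr_eq0 x (mulIf N1)); apply/eqP.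
Qed.

End ParallelScale.
End Metric.

(** * Symmetries of the Ricci tensor derived from those of the curvature *)

Section KahlerCurvature.
Context (G : 'M[R]_(n + n)) (Rm : 'I_(n + n) -> 'I_(n + n) -> 'M[R]_(n + n)).
Hypotheses (Gsym : G^T = G) (Gunit : G \in unitmx) (GJ : J0 *m G = G *m J0)
  (Ranti : forall a b, Rm b a = - Rm a b)
  (Bianchi : forall a b c d, Rm a b c d + Rm b d c a + Rm d a c b = 0)
  (Rskew : forall a b, (G *m Rm a b)^T = - (G *m Rm a b))
  (RJ : forall a b, J0 *m Rm a b = Rm a b *m J0).
Local Notation H := (invmx G).
Let K a b : 'M[R]_(n + n) := G *m Rm a b.

Let K_anti a b c d : K b a c d = - K a b c d.
Proof. by rewrite /K Ranti mulmxN mxE. Qed.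

Let K_skew a b c d : K a b d c = - K a b c d.
Proof. by have /matrixP/(_ c d) := Rskew a b; rewrite (mxE _ _ c d) (mxE _ _ c d). Qed.

Let K_bianchi a b c d : K a b c d + K b d c a + K d a c b = 0.
Proof.
rewrite /K !mxE -!big_split /= big1 // => e _.
by rewrite -!mulrDr Bianchi mulr0.
Qed.

(** The classical linear algebra: the Bianchi identity at four arrangements of the indices, reduced
    by the two antisymmetries. *)
Let K_pair a b c d : K a b c d = K c d a b.
Proof.
have e1 : K b d c a = K d b a c by rewrite K_anti K_skew opprK.
have e2 : K c a d b = K a c b d by rewrite K_anti K_skew opprK.
have := K_bianchi a b c d; have := K_bianchi a b d c.
have := K_bianchi b c a d; have := K_bianchi a c b d.
rewrite e1 e2 (K_skew d a b c) (K_skew c d a b) (K_skew a b c d) (K_skew b c a d).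
by move: (K a b c d) (K c d a b) (K d b a c) (K a c b d) (K d a b c) (K b c a d)
  => *; lra.
Qed.

Let Hs x y : H x y = H y x.
Proof. by move/matrixP/(_ y x) : (invmx_sym Gsym); rewrite mxE. Qed.

Let RicE b d : \sum_a Rm a b a d = \sum_a \sum_c H a c * K a b c d.
Proof.
by apply: eq_bigr => a _; rewrite -[in LHS](mulKmx Gunit (Rm a b)) mxE.
Qed.

Lemma Ricci_sym : (\matrix_(b, d) \sum_a Rm a b a d)^T =
  \matrix_(b, d) \sum_a Rm a b a d.
Proof.
apply/matrixP => b d; rewrite !mxE !RicE exchange_big /=.
apply: eq_bigr => c _; apply: eq_bigr => a _.
by rewrite Hs K_pair.
Qed.

(** J commutes with the last index pair of [K] by [RJ], hence with the first pair by [K_pair]. Both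
    sides become contractions of [K] with H J, one of them with the indices of H J exchanged and a
    minus sign; as H J is skew, they agree. *)
Lemma Ricci_std_J : J0 *m (\matrix_(b, d) \sum_a Rm a b a d) =
  (\matrix_(b, d) \sum_a Rm a b a d) *m J0.
Proof.
have KJ a b : J0 *m K a b = K a b *m J0 by rewrite /K mulmxA GJ -mulmxA RJ mulmxA.
have J0s x y : J0 x y = - J0 y x by move/matrixP/(_ y x): std_J_tr; rewrite !mxE.
have HJs x y : (H *m J0) x y = - (H *m J0) y x.
  have : (H *m J0)^T = - (H *m J0).
    by rewrite trmx_mul (invmx_sym Gsym) std_J_tr mulNmx invmx_std_J.
  by move/matrixP/(_ y x); rewrite (mxE _ _ y) (mxE _ _ y).
apply/matrixP => b e; rewrite [RHS]mxE [LHS]mxE.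
have -> : \sum_d (\matrix_(b, d) \sum_a Rm a b a d) b d * J0 d e =
    \sum_a \sum_c (H *m J0) a c * K a b c e.
  under eq_bigr do rewrite mxE RicE big_distrl.
  rewrite exchange_big; apply: eq_bigr => a _ /=.
  under eq_bigr do rewrite big_distrl.
  rewrite exchange_big /=.
  transitivity (\sum_c H a c * (J0 *m K a b) c e).
    apply: eq_bigr => c _; rewrite KJ mxE mulr_sumr.
    by apply: eq_bigr => d _; rewrite mulrA.
  under [RHS]eq_bigr do rewrite mxE big_distrl.
  rewrite [RHS]exchange_big; apply: eq_bigr => c _ /=.
  by rewrite mxE mulr_sumr; apply: eq_bigr => d _; rewrite mulrA.
have -> : \sum_d J0 b d * (\matrix_(b, d) \sum_a Rm a b a d) d e =
    - \sum_a \sum_c H a c * (J0 *m K c e) a b.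
  under eq_bigr do rewrite mxE RicE mulr_sumr.
  rewrite exchange_big -sumrN; apply: eq_bigr => a _ /=.
  under eq_bigr do rewrite mulr_sumr.
  rewrite exchange_big -sumrN; apply: eq_bigr => c _ /=.
  rewrite KJ mxE mulr_sumr -sumrN; apply: eq_bigr => d _.
  by rewrite (J0s d b) K_pair mulrN mulrN opprK mulrCA [K c e a d * _]mulrC.
transitivity (- \sum_a \sum_c (H *m J0) c a * K a b c e); last first.
  rewrite -sumrN; apply: eq_bigr => a _; rewrite -sumrN; apply: eq_bigr => c _.
  by rewrite (HJs a c) mulNr.
congr (- _); rewrite exchange_big [RHS]exchange_big; apply: eq_bigr => c _ /=.
transitivity (\sum_a \sum_d H c a * J0 a d * K d b c e).
  apply: eq_bigr => a _; rewrite mxE mulr_sumr; apply: eq_bigr => d _.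
  by rewrite Hs K_pair mulrA.
rewrite exchange_big; apply: eq_bigr => d _ /=.
by rewrite [(H *m J0) c d]mxE big_distrl.
Qed.

End KahlerCurvature.
End StandardJ.

(** * The Levi-Civita connection of a Kaehler metric *)

HB.lock Definition pderiv_mx (R : realType) (m p q : nat) (a : 'I_m)
    (A : 'rV[R]_m -> 'M[R]_(p, q)) (x : 'rV[R]_m) : 'M[R]_(p, q) :=
  \matrix_(i, j) pderiv a (fun z => A z i j) x.

Definition mx_derivable (R : realType) (m p q : nat) (a : 'I_m)
    (A : 'rV[R]_m -> 'M[R]_(p, q)) (x : 'rV[R]_m) : Prop :=
  forall i j, is_pderiv a (fun z => A z i j) x (pderiv_mx a A x i j).

Lemma pderiv_mxE (R : realType) (m p q : nat) (a : 'I_m)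
    (A : 'rV[R]_m -> 'M[R]_(p, q)) (x : 'rV[R]_m) i j :
  pderiv_mx a A x i j = pderiv a (fun z => A z i j) x.
Proof. by rewrite pderiv_mx.unlock mxE. Qed.

(** * Derivatives of matrix-valued functions *)

Section MatrixCalculus.
Context (R : realType) (m p q r : nat) (a : 'I_m) (x : 'rV[R]_m).

Lemma mx_derivable_ex (A : 'rV[R]_m -> 'M[R]_(p, q)) :
  (forall i j, exists d, is_pderiv a (fun z => A z i j) x d) ->
  mx_derivable a A x.
Proof.
move=> h i j; have [d hd] := h i j; rewrite pderiv_mxE.
by rewrite (is_pderiv_val hd).
Qed.

Lemma is_pderiv_mulmx (A : 'rV[R]_m -> 'M[R]_(p, q))
    (B : 'rV[R]_m -> 'M[R]_(q, r)) i j :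
  mx_derivable a A x -> mx_derivable a B x ->
  is_pderiv a (fun z => (A z *m B z) i j) x
    ((pderiv_mx a A x *m B x + A x *m pderiv_mx a B x) i j).
Proof.
move=> hA hB.
have -> : (fun z => (A z *m B z) i j) = fun z => \sum_k A z i k * B z k j.
  by apply/funext => z; rewrite mxE.
rewrite mxE [X in _ (X + _)]mxE [X in _ (_ + X)]mxE -big_split /=.
by apply: is_pderiv_sum => k _; apply: is_pderivM.
Qed.

Lemma mx_derivable_cst (A : 'M[R]_(p, q)) : mx_derivable a (fun=> A) x.
Proof. by apply: mx_derivable_ex => i j; exists 0; exact: is_pderiv_cst. Qed.

Lemma pderiv_mx_cst (A : 'M[R]_(p, q)) : pderiv_mx a (fun=> A) x = 0.
Proof.
by apply/matrixP => i j; rewrite pderiv_mxE mxE (is_pderiv_val (is_pderiv_cst a (A i j) x)).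
Qed.

Lemma pderiv_mx_open U (A B : 'rV[R]_m -> 'M[R]_(p, q)) : open U -> U x ->
  (forall z, U z -> A z = B z) -> pderiv_mx a A x = pderiv_mx a B x.
Proof.
move=> oU Ux AB; apply/matrixP => i j; rewrite !pderiv_mxE.
by apply: pderiv_open oU Ux _ => z /AB ->.
Qed.

Lemma pderiv_mx_tr (A : 'rV[R]_m -> 'M[R]_(p, q)) :
  pderiv_mx a (fun z => (A z)^T) x = (pderiv_mx a A x)^T.
Proof.
apply/matrixP => i j; rewrite mxE !pderiv_mxE; congr (pderiv a _ x).
by apply/funext => z; rewrite mxE.
Qed.

Lemma mx_derivable_tr (A : 'rV[R]_m -> 'M[R]_(p, q)) :
  mx_derivable a A x -> mx_derivable a (fun z => (A z)^T) x.
Proof.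
move=> hA i j; rewrite pderiv_mx_tr mxE.
have -> : (fun z => (A z)^T i j) = fun z => A z j i.
  by apply/funext => z; rewrite mxE.
exact: hA.
Qed.

Lemma pderiv_mxD (A B : 'rV[R]_m -> 'M[R]_(p, q)) :
  mx_derivable a A x -> mx_derivable a B x ->
  pderiv_mx a (fun z => A z + B z) x = pderiv_mx a A x + pderiv_mx a B x.
Proof.
move=> hA hB; apply/matrixP => i j; rewrite pderiv_mxE [RHS]mxE.
apply: is_pderiv_val.
have -> : (fun z => (A z + B z) i j) = fun z => A z i j + B z i j.
  by apply/funext => z; rewrite mxE.
exact: is_pderivD.
Qed.

Lemma pderiv_mxM (A : 'rV[R]_m -> 'M[R]_(p, q))
    (B : 'rV[R]_m -> 'M[R]_(q, r)) :
  mx_derivable a A x -> mx_derivable a B x ->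
  pderiv_mx a (fun z => A z *m B z) x =
  pderiv_mx a A x *m B x + A x *m pderiv_mx a B x.
Proof.
move=> hA hB; apply/matrixP => i j; rewrite pderiv_mxE.
exact: is_pderiv_val (is_pderiv_mulmx i j hA hB).
Qed.

Lemma mx_derivableM (A : 'rV[R]_m -> 'M[R]_(p, q))
    (B : 'rV[R]_m -> 'M[R]_(q, r)) :
  mx_derivable a A x -> mx_derivable a B x ->
  mx_derivable a (fun z => A z *m B z) x.
Proof.
move=> hA hB i j; rewrite pderiv_mxM //.
exact: is_pderiv_mulmx.
Qed.

End MatrixCalculus.

Lemma pderiv_mx_comm (R : realType) (m k : nat) (a : 'I_m) (x : 'rV[R]_m) U
    (A : 'rV[R]_m -> 'M[R]_k) (C : 'M[R]_k) :
  open U -> U x -> mx_derivable a A x ->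
  (forall z, U z -> C *m A z = A z *m C) ->
  C *m pderiv_mx a A x = pderiv_mx a A x *m C.
Proof.
move=> oU Ux hA comm; have := pderiv_mx_open a oU Ux comm.
have hC := mx_derivable_cst a x C.
rewrite !pderiv_mxM // !pderiv_mx_cst mul0mx mulmx0 add0r addr0.
by [].
Qed.

(** The value of the connection form in direction [a], as an endomorphism of column vectors; the
    curvature then becomes a curl plus a commutator of matrices. *)
HB.lock Definition christoffel_mx (R : realType) (n : nat)
    (g : 'rV[R]_(n + n) -> 'M[R]_(n + n)) (a : 'I_(n + n)) (x : 'rV[R]_(n + n)) :
  'M[R]_(n + n) := \matrix_(c, b) christoffel g c a b x.

HB.lock Definition curv_mx (R : realType) (n : nat)
    (g : 'rV[R]_(n + n) -> 'M[R]_(n + n)) (a b : 'I_(n + n)) (x : 'rV[R]_(n + n)) :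
  'M[R]_(n + n) := \matrix_(c, d) curv (christoffel g) a b c d x.

(** To be read with P and Q the Christoffel matrices in directions a and b, and A, B the crossed
    derivatives d_a Q, d_b P. As d_a g = G P + (G P)^T, the hypothesis is the symmetry of the second
    derivatives of g. The mixed terms (G P)^T Q occur with their transposes on both sides and
    cancel; what is left is the skewness of the lowered curvature. *)
Lemma skew_commutator (R : realType) (k : nat) (G A B P Q : 'M[R]_k) :
  G^T = G ->
  (G *m P + (G *m P)^T) *m Q + G *m A + ((G *m P + (G *m P)^T) *m Q + G *m A)^T =
  (G *m Q + (G *m Q)^T) *m P + G *m B + ((G *m Q + (G *m Q)^T) *m P + G *m B)^T ->
  (G *m (A - B + (P *m Q - Q *m P)))^T = - (G *m (A - B + (P *m Q - Q *m P))).
Proof.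
move=> Gs; rewrite !mulmxDl.
have -> : (G *m Q)^T *m P = ((G *m P)^T *m Q)^T.
  by rewrite [RHS]trmx_mul trmxK trmx_mul Gs mulmxA.
have -> : G *m (A - B + (P *m Q - Q *m P)) =
    G *m A - G *m B + (G *m P *m Q - G *m Q *m P).
  by rewrite !mulmxDr !mulmxN !mulmxA.
move: ((G *m P)^T *m Q) (G *m P *m Q) (G *m Q *m P) (G *m A) (G *m B).
move=> Y X1 X2 Z1 Z2 /matrixP e; apply/matrixP => i j; move: (e i j).
by rewrite !mxE => ?; lra.
Qed.

Section ChristoffelSymbols.
Context (R : realType) (n : nat) (g : 'rV[R]_(n + n) -> 'M[R]_(n + n)).

Lemma christoffel_mxE a x c b : christoffel_mx g a x c b = christoffel g c a b x.
Proof. by rewrite christoffel_mx.unlock mxE. Qed.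

Lemma curv_mx_entry a b x c d :
  curv_mx g a b x c d = curv (christoffel g) a b c d x.
Proof. by rewrite curv_mx.unlock mxE. Qed.

Lemma christoffelE c a b x : christoffel g c a b x =
  2^-1 * \sum_d invmx (g x) c d *
    (pderiv a (fun z => g z b d) x + pderiv b (fun z => g z a d) x
     - pderiv d (fun z => g z a b) x).
Proof. by []. Qed.

Lemma curvE a b c d x : curv (christoffel g) a b c d x =
  pderiv a (christoffel g c b d) x - pderiv b (christoffel g c a d) x
  + \sum_e (christoffel g c a e x * christoffel g e b d x -
             christoffel g c b e x * christoffel g e a d x).
Proof. by []. Qed.

End ChristoffelSymbols.

(** * Parallelism of the metric and of J, and symmetries of the curvature *)

Section Christoffel.
Context (R : realType) (n : nat) (U : set 'rV[R]_(n + n))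
  (g : 'rV[R]_(n + n) -> 'M[R]_(n + n)).
Local Notation J0 := (std_J R n).
Local Notation Gam := (christoffel g).
Hypotheses (oU : open U) (gsm : forall a b, smooth_on U (fun x => g x a b))
  (gsym : forall x, U x -> (g x)^T = g x)
  (gunit : forall x, U x -> g x \in unitmx)
  (gJ : forall x, U x -> J0 *m g x = g x *m J0)
  (gclosed : forall x, U x -> forall a b c : 'I_(n + n),
    pderiv a (fun z => kahler_form g z b c) x
    + pderiv b (fun z => kahler_form g z c a) x
    + pderiv c (fun z => kahler_form g z a b) x = 0).

Local Notation Gmx := (christoffel_mx g).

Local Notation dg a x := (pderiv_mx a g x).

Lemma metric_derivable a x : U x -> mx_derivable a g x.
Proof.
move=> Ux; apply: mx_derivable_ex => i j; eexists.
exact: smooth_on_is_pderiv (gsm i j) Ux.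
Qed.

Lemma dg_sym a x : U x -> (dg a x)^T = dg a x.
Proof. by move=> Ux; rewrite -pderiv_mx_tr; exact: (pderiv_mx_open a oU Ux gsym). Qed.

Lemma metric_symE x b d : U x -> g x b d = g x d b.
Proof. by move/gsym/matrixP/(_ d b); rewrite mxE. Qed.

Lemma pderiv_metric_sym a x b d : U x ->
  pderiv a (fun z => g z b d) x = pderiv a (fun z => g z d b) x.
Proof. by move=> Ux; apply: pderiv_open oU Ux _ => z; exact: metric_symE. Qed.

Lemma christoffel_sym x c a b : U x -> Gam c a b x = Gam c b a x.
Proof.
move=> Ux; rewrite !christoffelE; congr (_ * _); apply: eq_bigr => d _.
congr (_ * _); rewrite (pderiv_metric_sym d a b Ux).
by rewrite [X in X - _ = _]addrC.
Qed.

Lemma christoffel_derivable x e c a b : U x ->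
  is_pderiv e (Gam c a b) x (pderiv e (Gam c a b) x).
Proof.
move=> Ux; suff [d hd] : exists d, is_pderiv e (Gam c a b) x d.
  by rewrite (is_pderiv_val hd).
have hg i j k : is_pderiv e (pderiv k (fun z => g z i j)) x
    (pderiv e (pderiv k (fun z => g z i j)) x).
  exact: smooth_on_is_pderiv (smooth_on_pderiv k (gsm i j)) Ux.
have [d hd] : exists d, is_pderiv e (fun z => \sum_d invmx (g z) c d *
    (pderiv a (fun z => g z b d) z + pderiv b (fun z => g z a d) z
     - pderiv d (fun z => g z a b) z)) x d.
  apply: derivable_sum_ex => i _.
  have [d hd] := derivable_invmx (a := e) oU Ux gunit
    (fun i j => ex_intro _ _ (smooth_on_is_pderiv e (gsm i j) Ux)) c i.
  eexists; apply: is_pderivM hd _; apply: is_pderivB (hg _ _ _).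
  exact: is_pderivD.
exists (2^-1 * d).
rewrite (_ : Gam c a b = fun z => 2^-1 * \sum_d invmx (g z) c d *
    (pderiv a (fun z => g z b d) z + pderiv b (fun z => g z a d) z
     - pderiv d (fun z => g z a b) z)); first exact: is_pderivZ.
by apply/funext => z; exact: christoffelE.
Qed.

Lemma christoffel_mx_derivable e a x : U x -> mx_derivable e (Gmx a) x.
Proof.
move=> Ux; apply: mx_derivable_ex => i j; exists (pderiv e (Gam i a j) x).
have -> : (fun z => Gmx a z i j) = Gam i a j by apply/funext => z; rewrite christoffel_mxE.
exact: christoffel_derivable.
Qed.

Lemma lower_christoffel a x d b : U x -> (g x *m Gmx a x) d b =
  2^-1 * (dg a x b d + dg b x a d - dg d x a b).
Proof.
move=> Ux; pose v : 'cV[R]_(n + n) := \col_d (dg a x b d + dg b x a d - dg d x a b).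
have vE e : v e 0 = dg a x b e + dg b x a e - dg e x a b by rewrite mxE.
rewrite -vE; move: v vE => v vE.
have hG c : Gmx a x c b = 2^-1 * (invmx (g x) *m v) c 0.
  rewrite christoffel_mxE christoffelE; congr (_ * _).
  by rewrite [RHS]mxE; apply: eq_bigr => e _; rewrite vE !pderiv_mxE.
rewrite -[in RHS](mulKVmx (gunit Ux) v) [LHS]mxE [in RHS]mxE mulr_sumr.
by apply: eq_bigr => c _; rewrite hG mulrCA.
Qed.

(** This is nabla g = 0: in the sum of the two lowered Christoffel symbols the derivatives in
    directions other than [a] cancel. *)
Lemma metric_parallel a x : U x ->
  dg a x = g x *m Gmx a x + (g x *m Gmx a x)^T.
Proof.
move=> Ux; apply/matrixP => b c; rewrite [RHS]mxE [X in _ = _ + X]mxE.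
rewrite !lower_christoffel //.
have E i j k : dg i x j k = dg i x k j.
  by have /matrixP/(_ k j) := dg_sym i Ux; rewrite mxE.
by rewrite (E a c b); move: (dg a x b c) (dg b x a c) (dg c x a b) => u v w; field.
Qed.

Lemma dg_std_J a x : U x -> J0 *m dg a x = dg a x *m J0.
Proof.
by move=> Ux; apply: pderiv_mx_comm oU Ux (metric_derivable a Ux) gJ.
Qed.

Lemma pderiv_kahler a x b c : U x ->
  pderiv a (fun z => kahler_form g z b c) x = (J0 *m dg a x) b c.
Proof.
move=> Ux; have := pderiv_mxM (mx_derivable_cst a x J0) (metric_derivable a Ux).
rewrite pderiv_mx_cst mul0mx add0r => <-.
by rewrite pderiv_mxE.
Qed.

(** This is nabla J = 0: the components of the complex structure are constant in holomorphic
    coordinates, so only its commutator with the Christoffel matrix remains. The closedness of the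
    Kaehler form enters here. *)
Lemma christoffel_std_J a x : U x -> J0 *m Gmx a x = Gmx a x *m J0.
Proof.
move=> Ux; pose W k := J0 *m dg k x.
have Wskew k i j : W k i j = - W k j i.
  have : (W k)^T = - W k.
    by rewrite trmx_mul (dg_sym k Ux) std_J_tr mulmxN -(dg_std_J k Ux).
  by move/matrixP/(_ j i); rewrite [LHS]mxE [RHS]mxE.
have dgW k i j : dg k x i j = - \sum_l J0 i l * W k l j.
  have : J0 *m W k = - dg k x by exact: std_JK.
  by move/matrixP/(_ i j); rewrite [LHS]mxE [RHS]mxE => ->; rewrite opprK.
have cl i j k : W i j k + W j k i + W k i j = 0.
  by have := gclosed Ux i j k; rewrite !pderiv_kahler.
(* Since g_ad = - J_a^l W_ld, closedness of W turns d_b g_ad - d_d g_ab into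
   J_a^l d_l W_db, a combination of matrices commuting with J. *)
have L : g x *m Gmx a x = 2^-1 *: (dg a x + \sum_l J0 a l *: (J0 *m dg l x)).
  apply/matrixP => d b; rewrite lower_christoffel // [RHS]mxE; congr (_ * _).
  rewrite [RHS]mxE -addrA; congr (_ + _).
    by have /matrixP/(_ b d) := dg_sym a Ux; rewrite [LHS]mxE.
  rewrite !dgW opprK addrC -sumrB summxE; apply: eq_bigr => l _.
  rewrite [RHS]mxE -/(W l) -mulrBr; congr (_ * _).
  have := cl l d b; rewrite (Wskew d b l).
  by move: (W l d b) (W d l b) (W b l d) => u v w; lra.
have Lc : J0 *m (g x *m Gmx a x) = (g x *m Gmx a x) *m J0.
  rewrite L -scalemxAl -scalemxAr mulmxDl mulmxDr (dg_std_J a Ux); congr (_ *: (_ + _)).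
  rewrite mulmx_sumr mulmx_suml; apply: eq_bigr => l _.
  by rewrite -scalemxAl -scalemxAr -(mulmxA J0 (dg l x)) -(dg_std_J l Ux).
move: Lc; rewrite mulmxA gJ // -!mulmxA => /(congr1 (fun A => invmx (g x) *m A)).
by rewrite !(mulKmx (gunit Ux)).
Qed.

Lemma curv_mxE a b x : U x -> curv_mx g a b x =
  pderiv_mx a (Gmx b) x - pderiv_mx b (Gmx a) x
  + (Gmx a x *m Gmx b x - Gmx b x *m Gmx a x).
Proof.
move=> Ux; apply/matrixP => c d; rewrite curv_mx_entry curvE !mxE.
have e1 i j : pderiv_mx i (Gmx j) x c d = pderiv i (Gam c j d) x.
  by rewrite pderiv_mxE; congr (pderiv i _ x); apply/funext => z; rewrite christoffel_mxE.
by rewrite !e1 -sumrB; congr (_ + _); apply: eq_bigr => e _;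
  rewrite !christoffel_mxE.
Qed.

Lemma curv_mx_anti a b x : U x -> curv_mx g b a x = - curv_mx g a b x.
Proof. by move=> Ux; rewrite !curv_mxE // opprD !opprB. Qed.

Lemma curv_mx_std_J a b x : U x -> J0 *m curv_mx g a b x = curv_mx g a b x *m J0.
Proof.
move=> Ux; rewrite curv_mxE //.
have cd i j : J0 *m pderiv_mx i (Gmx j) x = pderiv_mx i (Gmx j) x *m J0.
  apply: pderiv_mx_comm oU Ux (christoffel_mx_derivable i j Ux) _ => z Uz.
  exact: christoffel_std_J.
have cc i j : J0 *m (Gmx i x *m Gmx j x) = Gmx i x *m Gmx j x *m J0.
  by rewrite mulmxA christoffel_std_J // -mulmxA christoffel_std_J // mulmxA.
move: (Gmx a x) (Gmx b x) (pderiv_mx a (Gmx b) x) (pderiv_mx b (Gmx a) x)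
  (cd a b) (cd b a) (cc a b) (cc b a) => A B C D c1 c2 c3 c4.
by rewrite mulmxDl mulmxDr !mulmxBl !mulmxBr c1 c2 c3 c4.
Qed.

Lemma curv_mx_skew a b x : U x ->
  (g x *m curv_mx g a b x)^T = - (g x *m curv_mx g a b x).
Proof.
move=> Ux.
have hL i j : mx_derivable i (fun z => g z *m Gmx j z) x.
  by apply: mx_derivableM; [exact: metric_derivable|exact: christoffel_mx_derivable].
have e1 i j : pderiv_mx i (fun z => dg j z) x =
    (dg i x *m Gmx j x + g x *m pderiv_mx i (Gmx j) x) +
    (dg i x *m Gmx j x + g x *m pderiv_mx i (Gmx j) x)^T.
  rewrite (pderiv_mx_open i oU Ux (fun z Uz => metric_parallel j Uz)).
  rewrite pderiv_mxD //; last exact: mx_derivable_tr.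
  rewrite pderiv_mx_tr pderiv_mxM //; first exact: metric_derivable.
  exact: christoffel_mx_derivable.
have e2 : pderiv_mx a (fun z => dg b z) x = pderiv_mx b (fun z => dg a z) x.
  apply/matrixP => i j; rewrite !pderiv_mxE.
  have dd k : (fun z => dg k z i j) = pderiv k (fun z => g z i j).
    by apply/funext => z; rewrite pderiv_mxE.
  rewrite !dd; exact: (pderivC a b oU Ux (gsm i j 2%N)).
move: e2; rewrite !e1 curv_mxE // (metric_parallel a Ux) (metric_parallel b Ux).
move: (pderiv_mx a _ x) (pderiv_mx b _ x) (Gmx a x) (Gmx b x) (g x) (gsym Ux)
  => A B P Q G Gs e2.
exact: skew_commutator.
Qed.

(** Absence of torsion makes the derivative terms [T] and the quadratic terms [S] symmetric in their
    last two indices, so that the cyclic sum cancels in pairs. *)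
Lemma curv_Bianchi a b c d x : U x ->
  curv_mx g a b x c d + curv_mx g b d x c a + curv_mx g d a x c b = 0.
Proof.
move=> Ux; rewrite !curv_mxE //.
pose T i j k := pderiv_mx i (Gmx j) x c k.
pose S i j k := (Gmx i x *m Gmx j x) c k.
have E i j k : (pderiv_mx i (Gmx j) x - pderiv_mx j (Gmx i) x
    + (Gmx i x *m Gmx j x - Gmx j x *m Gmx i x)) c k =
    T i j k - T j i k + (S i j k - S j i k).
  rewrite /T /S; move: (Gmx i x *m _) (Gmx j x *m _) (pderiv_mx i _ _) (pderiv_mx j _ _).
  by move=> *; rewrite !mxE.
have Ts i j k : T i j k = T i k j.
  rewrite /T !pderiv_mxE; apply: pderiv_open oU Ux _ => z Uz.
  by rewrite !christoffel_mxE; exact: christoffel_sym.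
have Ss i j k : S i j k = S i k j.
  rewrite /S !mxE; apply: eq_bigr => e _; congr (_ * _).
  by rewrite !christoffel_mxE; exact: christoffel_sym.
rewrite !E (Ts a d b) (Ts b d a) (Ts d b a) (Ss a d b) (Ss b d a) (Ss d b a).
by move: (T a b d) (T b a d) (T d a b) (S a b d) (S b a d) (S d a b) => *; ring.
Qed.

Lemma Ricci_curv_sym x : U x ->
  (\matrix_(b, d) \sum_a curv_mx g a b x a d)^T =
  \matrix_(b, d) \sum_a curv_mx g a b x a d.
Proof.
move=> Ux; apply: (@Ricci_sym R n (g x) (fun a b => curv_mx g a b x)).
- exact: gsym.
- exact: gunit.
- by move=> a b; exact: curv_mx_anti.
- by move=> a b c d; exact: curv_Bianchi.
- by move=> a b; exact: curv_mx_skew.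
Qed.

Lemma Ricci_curv_std_J x : U x ->
  J0 *m (\matrix_(b, d) \sum_a curv_mx g a b x a d) =
  (\matrix_(b, d) \sum_a curv_mx g a b x a d) *m J0.
Proof.
move=> Ux; apply: (@Ricci_std_J R n (g x) (fun a b => curv_mx g a b x)).
- exact: gsym.
- exact: gunit.
- exact: gJ.
- by move=> a b; exact: curv_mx_anti.
- by move=> a b c d; exact: curv_Bianchi.
- by move=> a b; exact: curv_mx_skew.
- by move=> a b; exact: curv_mx_std_J.
Qed.

End Christoffel.

(** * Curvature of the tractor connection *)

(* Sealed: unification would otherwise compare two partial derivatives by
   unfolding the limits that define them. *)
HB.lock Definition pd (R : realType) (m : nat) (a : 'I_m)
  (f : 'rV[R]_m -> R) (x : 'rV[R]_m) : R := pderiv a f x.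

Lemma pdE (R : realType) (m : nat) (a : 'I_m) (f : 'rV[R]_m -> R) :
  pderiv a f = pd a f.
Proof. by apply/funext => x; rewrite pd.unlock. Qed.

Lemma is_pd_val (R : realType) (m : nat) (a : 'I_m) (f : 'rV[R]_m -> R) x d :
  is_pderiv a f x d -> pd a f x = d.
Proof. by rewrite -pdE; exact: is_pderiv_val. Qed.

(** * Commutators of a tractor connection with arbitrary coefficients *)

Section AbstractTractor.
Context (R : realType) (m : nat) (Gam : 'I_m -> 'rV[R]_m -> 'M[R]_m)
  (J P Ji : 'rV[R]_m -> 'M[R]_m) (S : 'I_m -> 'rV[R]_m -> R).

(** The formula of [tractor_nabla] with free coefficients: its commutator is computed from the
    symmetry of [Gam] and the parallelism of [J], before the coefficients are tied to a metric. *)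
Definition tractor_conn (a : 'I_m) (Sig : 'rV[R]_m -> tractor R m) (x : 'rV[R]_m) :
    tractor R m :=
  (pd a (fun z => (Sig z).1.1) x - (Sig x).1.2 0 a,
   \row_b (pd a (fun z => (Sig z).1.2 0 b) x
           - \sum_c Gam a x c b * (Sig x).1.2 0 c
           + J x a b * (Sig x).2 + P x a b * (Sig x).1.1),
   pd a (fun z => (Sig z).2) x
     - (\sum_b \sum_c P x a b * Ji x b c * (Sig x).1.2 0 c)
     + S a x * (Sig x).1.1).

Lemma tractor_conn1 a Sig x : (tractor_conn a Sig x).1.1 =
  pd a (fun z => (Sig z).1.1) x - (Sig x).1.2 0 a.
Proof. by []. Qed.

Lemma tractor_conn2 a Sig x b : (tractor_conn a Sig x).1.2 0 b =
  pd a (fun z => (Sig z).1.2 0 b) x - \sum_c Gam a x c b * (Sig x).1.2 0 c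
  + J x a b * (Sig x).2 + P x a b * (Sig x).1.1.
Proof. by rewrite mxE. Qed.

Lemma tractor_conn3 a Sig x : (tractor_conn a Sig x).2 =
  pd a (fun z => (Sig z).2) x
     - (\sum_b \sum_c P x a b * Ji x b c * (Sig x).1.2 0 c)
     + S a x * (Sig x).1.1.
Proof. by []. Qed.

Context (U : set 'rV[R]_m) (oU : open U).
Hypotheses (Gsym : forall x, U x -> forall a b c, Gam a x c b = Gam b x c a)
  (dGam : forall x, U x -> forall a b, mx_derivable a (Gam b) x)
  (dJ : forall x, U x -> forall a b c, is_pderiv a (fun z => J z b c) x
    ((J x *m Gam a x) b c + ((Gam a x)^T *m J x) b c)).

Definition conn_curv (a b : 'I_m) x : 'M[R]_m := pderiv_mx a (Gam b) x
  - pderiv_mx b (Gam a) x + (Gam a x *m Gam b x - Gam b x *m Gam a x).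

Context (Sig : 'rV[R]_m -> tractor R m) (hS : tractor_smooth_on U Sig).
Local Notation sg := (fun z => (Sig z).1.1).
Local Notation mu c := (fun z => (Sig z).1.2 0 c).
Local Notation rh := (fun z => (Sig z).2).

Let pdC f a b x : smooth_on U f -> U x -> pd a (pd b f) x = pd b (pd a f) x.
Proof. by move=> hf Ux; rewrite -!pdE; exact: pderivC oU Ux (hf 2%N). Qed.

Let is_pd a f x : smooth_on U f -> U x -> is_pderiv a f x (pd a f x).
Proof. by move=> hf Ux; rewrite -pdE; exact: smooth_on_is_pderiv hf Ux. Qed.

Let is_pd2 a b f x : smooth_on U f -> U x ->
  is_pderiv a (pd b f) x (pd a (pd b f) x).
Proof.
move=> hf Ux; rewrite -!pdE.
exact: smooth_on_is_pderiv (smooth_on_pderiv b hf) Ux.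
Qed.

Let sg_smooth : smooth_on U sg. Proof. by case: hS. Qed.
Let mu_smooth c : smooth_on U (mu c). Proof. by case: hS. Qed.
Let rh_smooth : smooth_on U rh. Proof. by case: hS. Qed.

Lemma tractor_conn_comm1 a b x : U x ->
  (tractor_conn a (tractor_conn b Sig) x).1.1 - (tractor_conn b (tractor_conn a Sig) x).1.1 =
  (J x a b - J x b a) * (Sig x).2 + (P x a b - P x b a) * (Sig x).1.1.
Proof.
move=> Ux; have h u v : (tractor_conn u (tractor_conn v Sig) x).1.1 =
    pd u (pd v sg) x - pd u (mu v) x - (pd v (mu u) x
      - \sum_c Gam v x c u * (Sig x).1.2 0 c
      + J x v u * (Sig x).2 + P x v u * (Sig x).1.1).
  rewrite tractor_conn1 tractor_conn2; congr (_ - _).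
  apply: is_pd_val; apply: is_pderivB; first exact: is_pd2.
  exact: is_pd.
rewrite !h (pdC a b sg_smooth Ux).
have -> : \sum_c Gam b x c a * (Sig x).1.2 0 c = \sum_c Gam a x c b * (Sig x).1.2 0 c.
  by apply: eq_bigr => c _; rewrite (Gsym Ux).
move: (\sum_c _) (pd b (pd a sg) x) (pd a (mu b) x) (pd b (mu a) x) => *; ring.
Qed.

(** Derivability is asked of the product of [P] and sigma rather than of [P]. It can thus be
    supplied either by sigma = 0 or, later, by P = L g. *)
Lemma tractor_conn_comm2 a b c x : U x ->
  (forall a b, is_pderiv a (fun z => P z b c * (Sig z).1.1) x
     (pd a (fun z => P z b c * (Sig z).1.1) x)) ->
  (tractor_conn a (tractor_conn b Sig) x).1.2 0 c
  - (tractor_conn b (tractor_conn a Sig) x).1.2 0 c =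
  - (\sum_e conn_curv a b x e c * (Sig x).1.2 0 e)
  - P x a c * (Sig x).1.2 0 b + P x b c * (Sig x).1.2 0 a
  - J x a c * (\sum_d \sum_e P x b d * Ji x d e * (Sig x).1.2 0 e)
  + J x b c * (\sum_d \sum_e P x a d * Ji x d e * (Sig x).1.2 0 e)
  + (pd a (fun z => P z b c * (Sig z).1.1) x
     - (\sum_e Gam a x e c * P x b e) * (Sig x).1.1
     + J x a c * (S b x * (Sig x).1.1) + P x a c * pd b sg x)
  - (pd b (fun z => P z a c * (Sig z).1.1) x
     - (\sum_e Gam b x e c * P x a e) * (Sig x).1.1
     + J x b c * (S a x * (Sig x).1.1) + P x b c * pd a sg x).
Proof.
move=> Ux hPs.
pose mm e := (Sig x).1.2 0 e.
(* [X] and [Y] come from differentiating Gam mu, [W] from Gam Gam mu, and [V], [Z] from the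
   derivative of J. [V] cancels within each second derivative, [Y] and [Z] cancel in the commutator,
   and [X] with [W] build the curvature. *)
pose X u v := \sum_e pderiv_mx u (Gam v) x e c * mm e.
pose Y u v := \sum_e Gam v x e c * pd u (mu e) x.
pose W u v := \sum_e Gam u x e c * \sum_f Gam v x f e * mm f.
pose V u v := \sum_e Gam u x e c * J x v e.
pose Z u v := \sum_e Gam u x e v * J x e c.
have h u v : (tractor_conn u (tractor_conn v Sig) x).1.2 0 c =
    pd u (pd v (mu c)) x - (X u v + Y u v) + ((V u v + Z u v) * (Sig x).2 +
      J x v c * pd u rh x) + pd u (fun z => P z v c * (Sig z).1.1) x
    - (Y v u - W u v + V u v * (Sig x).2 +
       (\sum_e Gam u x e c * P x v e) * (Sig x).1.1)
    + J x u c * (pd v rh x - (\sum_d \sum_e P x v d * Ji x d e * mm e)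
      + S v x * (Sig x).1.1) + P x u c * (pd v sg x - mm v).
  rewrite tractor_conn2 tractor_conn1 tractor_conn3; congr (_ - _ + _ + _).
    apply: is_pd_val.
    have -> : (fun z => (tractor_conn v Sig z).1.2 0 c) = fun z => pd v (mu c) z
        - \sum_e Gam v z e c * (Sig z).1.2 0 e + J z v c * (Sig z).2
        + P z v c * (Sig z).1.1.
      by apply/funext => z; rewrite tractor_conn2.
    apply: is_pderivD (hPs u v); apply: is_pderivD.
      apply: is_pderivB; first exact: is_pd2.
      rewrite /X /Y -big_split /=; apply: is_pderiv_sum => e _.
      by apply: is_pderivM; [exact: dGam|exact: is_pd].
    have -> : V u v + Z u v = (J x *m Gam u x) v c + ((Gam u x)^T *m J x) v c.
      rewrite /V /Z [(J x *m _) v c]mxE [(_^T *m _) v c]mxE; congr (_ + _).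
        by apply: eq_bigr => e _; rewrite mulrC.
      by apply: eq_bigr => e _; rewrite mxE.
    by apply: is_pderivM; [exact: dJ|exact: is_pd].
  transitivity (\sum_e (Gam u x e c * pd v (mu e) x
      - Gam u x e c * \sum_f Gam v x f e * mm f
      + Gam u x e c * J x v e * (Sig x).2
      + Gam u x e c * P x v e * (Sig x).1.1)).
    by apply: eq_bigr => e _; rewrite tractor_conn2 -/(mm _) !mulrDr mulrN !mulrA.
  by rewrite !big_split /= sumrN -!mulr_suml.
have Zs : Z a b = Z b a.
  by apply: eq_bigr => e _; rewrite (Gsym Ux).
have rmE : \sum_e conn_curv a b x e c * (Sig x).1.2 0 e = X a b - X b a + (W b a - W a b).
  have Wc u v : W v u = \sum_e (Gam u x *m Gam v x) e c * mm e.
    rewrite /W; under eq_bigr do rewrite mulr_sumr.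
    rewrite exchange_big; apply: eq_bigr => f _ /=.
    rewrite mxE mulr_suml; apply: eq_bigr => e _.
    by rewrite mulrA [Gam v x e c * _]mulrC.
  rewrite !Wc /X -!sumrB -big_split; apply: eq_bigr => e _ /=.
  rewrite -!mulrBl -mulrDl; congr (_ * _); rewrite /conn_curv.
  by move: (Gam a x *m _) (Gam b x *m _) (pderiv_mx a _ x) (pderiv_mx b _ x) => *;
    rewrite !mxE.
rewrite !h rmE (pdC a b (mu_smooth c) Ux) Zs -/(mm a) -/(mm b).
move: (X a b) (X b a) (Y a b) (Y b a) (W a b) (W b a) (V a b) (V b a) (Z b a).
move: (pd b (pd a (mu c)) x) (pd a rh x) (pd b rh x) (pd a sg x) (pd b sg x).
move: (pd a (fun z => P z b c * _) x) (pd b (fun z => P z a c * _) x).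
move: (\sum_e Gam a x e c * P x b e) (\sum_e Gam b x e c * P x a e).
move: (\sum_d \sum_e P x b d * Ji x d e * mm e) (\sum_d \sum_e P x a d * Ji x d e * mm e).
by move=> *; ring.
Qed.

End AbstractTractor.

HB.lock Definition Phi_mx (R : realType) (n : nat)
    (g : 'rV[R]_(n + n) -> 'M[R]_(n + n)) (x : 'rV[R]_(n + n)) : 'M[R]_(n + n) :=
  tractor_Phi (christoffel g) x.

HB.lock Definition Jinv_mx (R : realType) (n : nat)
    (g : 'rV[R]_(n + n) -> 'M[R]_(n + n)) (x : 'rV[R]_(n + n)) : 'M[R]_(n + n) :=
  Jinv (kahler_form g) x.

HB.lock Definition S_cov (R : realType) (n : nat)
    (g : 'rV[R]_(n + n) -> 'M[R]_(n + n)) (a : 'I_(n + n))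
    (x : 'rV[R]_(n + n)) : R :=
  tractor_S (kahler_form g) (christoffel g) a x.

(** * The commutators for a Kaehler metric *)

Section KahlerTractor.
Context (R : realType) (n : nat) (U : set 'rV[R]_(n + n))
  (g : 'rV[R]_(n + n) -> 'M[R]_(n + n)).
Local Notation J0 := (std_J R n).
Local Notation Gam := (christoffel g).
Local Notation Gmx := (christoffel_mx g).
Local Notation J := (kahler_form g).
Local Notation P := (Phi_mx g).
Local Notation S := (S_cov g).
Local Notation nabg := (tractor_conn Gmx J P (Jinv_mx g) S).
Hypotheses (oU : open U) (gsm : forall a b, smooth_on U (fun x => g x a b))
  (gsym : forall x, U x -> (g x)^T = g x)
  (gunit : forall x, U x -> g x \in unitmx)
  (gJ : forall x, U x -> J0 *m g x = g x *m J0)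
  (gclosed : forall x, U x -> forall a b c : 'I_(n + n),
    pderiv a (fun z => kahler_form g z b c) x
    + pderiv b (fun z => kahler_form g z c a) x
    + pderiv c (fun z => kahler_form g z a b) x = 0).

Lemma tractor_nabla_conn a Sig : tractor_nabla J Gam a Sig = nabg a Sig.
Proof.
apply/funext => x; rewrite /tractor_nabla /tractor_conn Phi_mx.unlock S_cov.unlock
  Jinv_mx.unlock !pdE; congr (_, _, _).
apply/rowP => b; rewrite mxE [RHS]mxE /cov1 pdE; congr (_ - _ + _ + _).
by apply: eq_bigr => c _; rewrite christoffel_mxE.
Qed.

(** The Christoffel terms of the outer derivative are symmetric in [a] and [b], so the coupled
    commutator is the plain one. *)
Lemma nabla2_comm a b Sig x : U x ->
  tractor_nabla2 J Gam a b Sig x - tractor_nabla2 J Gam b a Sig x =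
  nabg a (nabg b Sig) x - nabg b (nabg a Sig) x.
Proof.
move=> Ux; rewrite /tractor_nabla2 !tractor_nabla_conn.
have -> : \sum_e Gam e b a x *: tractor_nabla J Gam e Sig x =
    \sum_e Gam e a b x *: tractor_nabla J Gam e Sig x.
  by apply: eq_bigr => e _; rewrite (christoffel_sym oU gsym e a b Ux).
by rewrite opprB addrA subrK.
Qed.

Lemma Gmx_sym x : U x -> forall a b c, Gmx a x c b = Gmx b x c a.
Proof.
move=> Ux a b c; rewrite !christoffel_mxE.
exact: (christoffel_sym oU gsym).
Qed.

(** Differentiate J = J0 g by [metric_parallel] and move J0 past the transposed Christoffel matrix
    by [christoffel_std_J]. *)
Lemma kahler_parallel x : U x -> forall a b c, is_pderiv a (fun z => J z b c) x
    ((J x *m Gmx a x) b c + ((Gmx a x)^T *m J x) b c).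
Proof.
move=> Ux a b c; have dJ := mx_derivable_cst a x J0.
have dg := metric_derivable gsm a Ux.
apply: is_pderiv_eq (is_pderiv_mulmx b c dJ dg) _.
rewrite pderiv_mx_cst mul0mx add0r (metric_parallel oU gsym gunit a Ux).
rewrite /kahler_form mulmxDr [LHS]mxE mulmxA; congr (_ + _).
rewrite trmx_mul (gsym Ux) !mulmxA; congr ((_ *m _) b c).
have := christoffel_std_J oU gsm gsym gunit gJ gclosed a Ux.
move/(congr1 trmx); rewrite !trmx_mul std_J_tr mulmxN mulNmx => /oppr_inj ->.
by [].
Qed.

Lemma conn_curv_mx a b x : U x -> conn_curv Gmx a b x = curv_mx g a b x.
Proof. by move=> Ux; rewrite (curv_mxE _ _ _ Ux). Qed.

Lemma Phi_mxE x : P x = (2 * n.+1)%:R^-1 *: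
  (\matrix_(b, d) \sum_a curv_mx g a b x a d).
Proof.
rewrite Phi_mx.unlock; apply/matrixP => b d; rewrite mxE [RHS]mxE; congr (_ * _).
by rewrite mxE; apply: eq_bigr => a _; rewrite curv_mx_entry.
Qed.

Lemma Phi_sym x : U x -> (P x)^T = P x.
Proof.
move=> Ux; rewrite Phi_mxE linearZ /=; congr (_ *: _).
exact: (Ricci_curv_sym oU gsm gsym gunit Ux).
Qed.

Lemma Phi_std_J x : U x -> J0 *m P x = P x *m J0.
Proof.
move=> Ux; rewrite Phi_mxE -scalemxAr -scalemxAl; congr (_ *: _).
exact: (Ricci_curv_std_J oU gsm gsym gunit gJ gclosed Ux).
Qed.

Lemma Phi_Ricci x b d : \sum_a curv_mx g a b x a d = (2 * n.+1)%:R * P x b d.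
Proof.
by rewrite Phi_mxE !mxE mulVKf // pnatr_eq0.
Qed.

Lemma Jinv_mxE x : U x -> Jinv_mx g x = invmx (g x) *m J0.
Proof.
by move=> Ux; rewrite Jinv_mx.unlock; exact: kahler_inv (gsym Ux) (gunit Ux) (gJ Ux).
Qed.

Context (Sig : 'rV[R]_(n + n) -> tractor R (n + n)) (hS : tractor_smooth_on U Sig).
Local Notation sg := (fun z => (Sig z).1.1).
Local Notation mm x e := ((Sig x).1.2 0 e).

(** The part of the middle slot that is algebraic in mu: the curvature of the 1-forms, and the terms
    produced by passing through the outer slots. *)
Definition mu_curv a b c x : R :=
  - (\sum_e curv_mx g a b x e c * mm x e)
  - P x a c * mm x b + P x b c * mm x a
  - J x a c * (\sum_d \sum_e P x b d * Jinv_mx g x d e * mm x e)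
  + J x b c * (\sum_d \sum_e P x a d * Jinv_mx g x d e * mm x e).

Lemma kahler_skewE x a b : U x -> J x b a = - J x a b.
Proof.
by move=> Ux; have /matrixP/(_ a b) := kahler_skew (gsym Ux) (gJ Ux);
  rewrite [LHS]mxE [RHS]mxE.
Qed.

Lemma curvature1 a b x : U x ->
  (nabg a (nabg b Sig) x - nabg b (nabg a Sig) x).1.1 = 2 * J x a b * (Sig x).2.
Proof.
move=> Ux; transitivity ((nabg a (nabg b Sig) x).1.1 - (nabg b (nabg a Sig) x).1.1).
  by [].
rewrite (tractor_conn_comm1 _ _ _ _ oU Gmx_sym hS) // (kahler_skewE a b Ux).
have /matrixP/(_ a b) := Phi_sym Ux; rewrite mxE => ->.
by rewrite subrr mul0r addr0; move: (J x a b) => *; ring.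
Qed.

Lemma curvature2_sigma0 a b c x : U x -> (forall z, U z -> sg z = 0) ->
  (nabg a (nabg b Sig) x - nabg b (nabg a Sig) x).1.2 0 c = mu_curv a b c x.
Proof.
move=> Ux s0; transitivity ((nabg a (nabg b Sig) x).1.2 0 c -
    (nabg b (nabg a Sig) x).1.2 0 c); first by rewrite [LHS]mxE [X in _ + X]mxE.
have z0 i j k : is_pderiv i (fun z => P z j k * sg z) x 0.
  apply: is_pderiv_open oU Ux _ (is_pderiv_cst i 0 x) => z Uz.
  by rewrite s0 // mulr0.
have z1 i : pd i sg x = 0.
  apply: is_pd_val; apply: is_pderiv_open oU Ux _ (is_pderiv_cst i 0 x) => z Uz.
  by rewrite s0.
have dG z : U z -> forall i j, mx_derivable i (Gmx j) z.
  by move=> Uz i j; exact: (christoffel_mx_derivable oU gsm gunit).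
have H i j : is_pderiv i (fun z => P z j c * sg z) x
    (pd i (fun z => P z j c * sg z) x) by rewrite (is_pd_val (z0 i j c)).
rewrite (@tractor_conn_comm2 _ _ _ _ _ _ _ _ oU Gmx_sym dG kahler_parallel _ hS a b c x Ux H).
rewrite (is_pd_val (z0 a b c)) (is_pd_val (z0 b a c)) !z1 (s0 x Ux) conn_curv_mx // /mu_curv.
by rewrite !(mulr0, subr0, addr0).
Qed.

Section ScalarPhi.
Context (L : 'rV[R]_(n + n) -> R) (Lsm : smooth_on U L).
Hypothesis (PL : forall x, U x -> P x = L x *: g x).

Definition grad x : 'cV[R]_(n + n) := \col_a pd a L x.

Lemma Phi_pderiv a b c x : U x -> is_pderiv a (fun z => P z b c) x
  (pd a L x * g x b c + L x * ((g x *m Gmx a x) b c + (g x *m Gmx a x) c b)).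
Proof.
move=> Ux; apply: (is_pderiv_open (f := fun z => L z * g z b c) oU Ux).
  by move=> z /PL ->; rewrite mxE.
apply: is_pderivM.
  by rewrite -pdE; exact: smooth_on_is_pderiv Lsm Ux.
have dg := metric_derivable gsm a Ux; apply: is_pderiv_eq (dg b c) _.
by rewrite (metric_parallel oU gsym gunit a Ux) mxE [X in _ + X]mxE.
Qed.

(** Since g is parallel, nabla_c Phi_ab = (d_c L) g_ab, and contraction with J^bc turns g into the
    complex structure acting on the gradient. *)
Lemma S_covE a x : U x -> S a x = ((2 * n + 1)%:R^-1 *: (J0 *m grad x)) a 0.
Proof.
move=> Ux; rewrite S_cov.unlock /tractor_S [RHS]mxE; congr (_ * _).
have cov b c : cov2 Gam (tractor_Phi Gam) c a b x = pd c L x * g x a b.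
  have tP : tractor_Phi Gam = P by apply/funext => z; rewrite Phi_mx.unlock.
  rewrite /cov2 tP (is_pderiv_val (Phi_pderiv c a b Ux)) (PL Ux).
  have -> : \sum_e Gam e c a x * (L x *: g x) e b = L x * (g x *m Gmx c x) b a.
    rewrite [in RHS]mxE mulr_sumr; apply: eq_bigr => e _.
    by rewrite christoffel_mxE mxE (metric_symE gsym e b Ux) mulrCA mulrA mulrAC mulrA.
  have -> : \sum_e Gam e c b x * (L x *: g x) a e = L x * (g x *m Gmx c x) a b.
    rewrite [in RHS]mxE mulr_sumr; apply: eq_bigr => e _.
    by rewrite christoffel_mxE mxE mulrCA mulrA mulrAC mulrA.
  move: ((g x *m _) a b) ((g x *m _) b a) (pd c L x) => *; ring.
transitivity ((g x *m (Jinv_mx g x *m grad x)) a 0); last first.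
  by rewrite Jinv_mxE // !mulmxA (mulmxV (gunit Ux)) mul1mx.
rewrite mxE; apply: eq_bigr => b _; rewrite mxE mulr_sumr; apply: eq_bigr => c _.
rewrite cov Jinv_mx.unlock [grad x c 0]mxE [RHS]mulrCA; congr (_ * _).
by rewrite mulrC.
Qed.

(** The derivatives of sigma cancel between the derivative of Phi sigma and the Phi-multiple of the
    first slot. The terms in sigma that survive come from nabla Phi, where g is parallel, and from
    S. *)
Lemma curvature2_scalar a b c x : U x ->
  (nabg a (nabg b Sig) x - nabg b (nabg a Sig) x).1.2 0 c = mu_curv a b c x +
  (grad x a 0 * g x b c - grad x b 0 * g x a c
   + J x a c * ((2 * n + 1)%:R^-1 *: (J0 *m grad x)) b 0
   - J x b c * ((2 * n + 1)%:R^-1 *: (J0 *m grad x)) a 0) * (Sig x).1.1.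
Proof.
move=> Ux; transitivity ((nabg a (nabg b Sig) x).1.2 0 c -
    (nabg b (nabg a Sig) x).1.2 0 c); first by rewrite [LHS]mxE [X in _ + X]mxE.
have hs i : is_pderiv i sg x (pd i sg x).
  by case: hS => h _ _; rewrite -pdE; exact: smooth_on_is_pderiv h Ux.
have hP i j k := is_pderivM (Phi_pderiv i j k Ux) (hs i).
have dG z : U z -> forall i j, mx_derivable i (Gmx j) z.
  by move=> Uz i j; exact: (christoffel_mx_derivable oU gsm gunit).
have H i j : is_pderiv i (fun z => P z j c * sg z) x
    (pd i (fun z => P z j c * sg z) x).
  by rewrite (is_pd_val (hP i j c)); exact: hP.
rewrite (@tractor_conn_comm2 _ _ _ _ _ _ _ _ oU Gmx_sym dG kahler_parallel _ hS a b c x Ux H).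
rewrite (is_pd_val (hP a b c)) (is_pd_val (hP b a c)) conn_curv_mx // -!S_covE //.
rewrite /mu_curv ![grad x _ 0]mxE.
have h u v : \sum_e Gmx u x e c * P x v e = L x * (g x *m Gmx u x) v c.
  rewrite [in RHS]mxE mulr_sumr; apply: eq_bigr => e _.
  by rewrite (PL Ux) mxE mulrCA [Gmx u x e c * _]mulrC.
have Gs : (g x *m Gmx a x) c b = (g x *m Gmx b x) c a.
  by rewrite !mxE; apply: eq_bigr => e _; rewrite (Gmx_sym Ux a b).
rewrite !h Gs; have hPx i j : P x i j = L x * g x i j by rewrite (PL Ux) mxE.
rewrite !hPx.
move: ((g x *m Gmx a x) b c) ((g x *m Gmx b x) a c) ((g x *m Gmx b x) c a).
move: (\sum_d \sum_e P x b d * Jinv_mx g x d e * mm x e).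
move: (\sum_d \sum_e P x a d * Jinv_mx g x d e * mm x e).
move: (\sum_e curv_mx g a b x e c * mm x e) (S a x) (S b x) (pd a L x) (pd b L x).
by move: (pd a sg x) (pd b sg x) (J x a c) (J x b c) => *; ring.
Qed.

End ScalarPhi.

Section ConstantPhi.
Context (L : R).
Hypothesis (PL : forall x, U x -> P x = L *: g x).

Lemma S_cov0 a x : U x -> S a x = 0.
Proof.
move=> Ux; have Lsm : smooth_on U (fun=> L) by move=> k; exact: Ck_on_cst.
rewrite (S_covE Lsm PL) // (_ : grad _ x = 0) ?mulmx0 ?scaler0 ?mxE //.
apply/colP => i; rewrite [LHS]mxE [RHS]mxE.
exact: is_pd_val (is_pderiv_cst i L x).
Qed.

Lemma curvature2_constant a b c x : U x ->
  (nabg a (nabg b Sig) x - nabg b (nabg a Sig) x).1.2 0 c = mu_curv a b c x.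
Proof.
move=> Ux; have Lsm : smooth_on U (fun=> L) by move=> k; exact: Ck_on_cst.
rewrite (curvature2_scalar Lsm PL) // (_ : grad _ x = 0).
  by rewrite mulmx0 scaler0 !mxE !(mul0r, mulr0) !subr0 addr0 mul0r addr0.
apply/colP => i; rewrite [LHS]mxE [RHS]mxE.
exact: is_pd_val (is_pderiv_cst i L x).
Qed.

Lemma PhiJinv_mul x v a : U x ->
  \sum_d \sum_e P x a d * Jinv_mx g x d e * v e = L * \sum_e J0 a e * v e.
Proof.
move=> Ux; rewrite exchange_big mulr_sumr; apply: eq_bigr => e _ /=.
rewrite -mulr_suml mulrA; congr (_ * _).
transitivity ((P x *m Jinv_mx g x) a e); first by rewrite mxE.
by rewrite (PL Ux) (Jinv_mxE Ux) -scalemxAl mulmxA (mulmxV (gunit Ux)) mul1mx mxE.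
Qed.

(** With Phi = L g and S = 0 the last slot of the connection is d rho - L J mu. In the commutator
    the second derivatives of rho, the first derivatives of mu and the terms in g cancel by
    symmetry, leaving only the skew L^2 J sigma. *)
Lemma curvature3_constant a b x : U x ->
  (nabg a (nabg b Sig) x - nabg b (nabg a Sig) x).2 =
  - (2 * J x a b * (L ^+ 2 * (Sig x).1.1)).
Proof.
move=> Ux; transitivity ((nabg a (nabg b Sig) x).2 - (nabg b (nabg a Sig) x).2).
  by [].
have [sgs mus rhs] := hS.
pose rh z := (Sig z).2.
pose D u v := \sum_e J0 v e * pd u (fun z => (Sig z).1.2 0 e) x.
pose Z u v := \sum_e J0 u e * \sum_f Gmx v x f e * mm x f.
have JJ u v : \sum_e J0 u e * J x v e = g x u v.
  transitivity ((J0 *m (J x)^T) u v).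
    by rewrite [RHS]mxE; apply: eq_bigr => e _; rewrite [(J x)^T e v]mxE.
  by rewrite (kahler_skew (gsym Ux) (gJ Ux)) mulmxN std_JK opprK.
have Jg u v : \sum_e J0 u e * g x v e = J x u v.
  by rewrite [RHS]mxE; apply: eq_bigr => e _; rewrite (metric_symE gsym v e Ux).
have h u v : (nabg u (nabg v Sig) x).2 = pd u (pd v rh) x - L * D u v
    - L * (D v u - Z u v + g x u v * rh x + L * J x u v * (Sig x).1.1).
  rewrite tractor_conn3 (S_cov0 u Ux) mul0r addr0 (PhiJinv_mul _ _ Ux); congr (_ - _ * _).
    apply: is_pd_val.
    apply: (is_pderiv_open (f := fun z => pd v rh z -
        L * \sum_e J0 v e * (Sig z).1.2 0 e) oU Ux).
      by move=> z Uz; rewrite tractor_conn3 (S_cov0 v Uz) mul0r addr0 (PhiJinv_mul _ _ Uz).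
    apply: is_pderivB.
      rewrite -!pdE; exact: smooth_on_is_pderiv (smooth_on_pderiv v rhs) Ux.
    apply: is_pderivZ; apply: is_pderiv_sum => e _; apply: is_pderivZ.
    rewrite -!pdE; exact: smooth_on_is_pderiv (mus e) Ux.
  rewrite -JJ -Jg /D /Z mulr_suml mulr_sumr mulr_suml -sumrB -!big_split /=.
  apply: eq_bigr => e _; rewrite (tractor_conn2 Gmx J P (Jinv_mx g) S).
  have -> : P x v e = L * g x v e by rewrite (PL Ux) mxE.
  rewrite -/(rh x).
  move: (\sum_f _) (pd v _ x) (J x v e) => *; ring.
(* Commuting J past the Christoffel matrix brings [u] and [v] to its two symmetric lower indices. *)
have Zs : Z a b = Z b a.
  have ZE u v : Z u v = - \sum_f (J0 *m Gmx v x) f u * mm x f.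
    rewrite (christoffel_std_J oU gsm gsym gunit gJ gclosed v Ux).
    rewrite /Z -sumrN; under eq_bigr do rewrite mulr_sumr.
    rewrite exchange_big; apply: eq_bigr => f _ /=.
    rewrite mxE mulr_suml -sumrN; apply: eq_bigr => e _.
    have /matrixP/(_ e u) := std_J_tr R n; rewrite [LHS]mxE [RHS]mxE => ->.
    by rewrite mulNr mulrCA mulrA.
  rewrite !ZE; congr (- _); apply: eq_bigr => f _; congr (_ * _).
  by rewrite !mxE; apply: eq_bigr => e _; rewrite (Gmx_sym Ux).
have pC : pd a (pd b rh) x = pd b (pd a rh) x.
  by rewrite -!pdE; exact: (pderivC a b oU Ux (rhs 2%N)).
rewrite !h pC Zs (kahler_skewE a b Ux) (metric_symE gsym b a Ux).
move: (D a b) (D b a) (Z b a) (g x a b) (J x a b) (rh x) (pd b _ x) => *; ring.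
Qed.

End ConstantPhi.
End KahlerTractor.

(** * Flatness and constant holomorphic sectional curvature *)

Lemma sum_delta_row (R : realType) (m : nat) (F : 'I_m -> R) (e : 'I_m) :
  \sum_d F d * (delta_mx 0 e : 'rV[R]_m) 0 d = F e.
Proof.
rewrite (bigD1 e) //= mxE !eqxx mulr1 big1 ?addr0 // => d /negPf de.
by rewrite mxE de andbF mulr0.
Qed.

Lemma tractor_eq (R : realType) (m : nat) (u v : tractor R m) :
  u.1.1 = v.1.1 -> u.1.2 = v.1.2 -> u.2 = v.2 -> u = v.
Proof. by case: u v => [[? ?] ?] [[? ?] ?] /= -> -> ->. Qed.

Section KahlerManifold.
Context (R : realType) (n : nat) (M : complexManifold R n) (g : kahlerMetric M).
Implicit Types (i j : mindex M) (x : 'rV[R]_(n + n)).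
Local Notation J0 := (std_J R n).
Local Notation U := chart_img.

Let oU i : open (U i). Proof. exact: chart_img_open. Qed.

Let gsm i a b : smooth_on (U i) (fun x => g i x a b).
Proof. exact: metric_smooth. Qed.

Let gsym i x : U i x -> (g i x)^T = g i x.
Proof. exact: Defs.metric_sym. Qed.

Lemma metric_unit i x : U i x -> g i x \in unitmx.
Proof.
move=> ix; rewrite unitmxE unitfE; apply/negP => /det0P[v v0 vg].
by have := metric_pos g ix v0; rewrite vg mul0mx mxE ltxx.
Qed.
Local Notation gunit := metric_unit.

Lemma metric_std_J i x : U i x -> J0 *m g i x = g i x *m J0.
Proof.
move=> ix; have := metric_hermitian g ix; rewrite std_J_tr mulmxN => E.
by rewrite -[in RHS]E mulNmx std_JKr opprK.
Qed.
Local Notation gJ := metric_std_J.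

Let gcl i x : U i x -> forall a b c : 'I_(n + n),
    pderiv a (fun z => kahler_form (g i) z b c) x
    + pderiv b (fun z => kahler_form (g i) z c a) x
    + pderiv c (fun z => kahler_form (g i) z a b) x = 0.
Proof. exact: kahler_closed. Qed.

Local Notation P i := (Phi_mx (g i)).
Local Notation Rm i := (curv_mx (g i)).
Local Notation J i := (kahler_form (g i)).
Local Notation H i x := (invmx (g i x)).

Lemma mu_curv_delta i x (Sig : 'rV[R]_(n + n) -> tractor R (n + n)) a b c e :
  U i x -> (Sig x).1.2 = delta_mx 0 e ->
  mu_curv (g i) Sig a b c x = - Rm i a b x e c - P i x a c * (b == e)%:R
    + P i x b c * (a == e)%:R - J i x a c * (P i x *m (H i x *m J0)) b e
    + J i x b c * (P i x *m (H i x *m J0)) a e.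
Proof.
move=> ix hS; rewrite /mu_curv hS (sum_delta_row (fun e => Rm i a b x e c)).
have hP u : \sum_d \sum_f P i x u d * Jinv_mx (g i) x d f *
    (delta_mx 0 e : 'rV[R]_(n + n)) 0 f = (P i x *m (H i x *m J0)) u e.
  rewrite -(Jinv_mxE (@gsym i) (@gunit i) (@gJ i) ix) [RHS]mxE.
  by apply: eq_bigr => d _; rewrite (sum_delta_row (fun f => P i x u d * Jinv_mx (g i) x d f)).
by rewrite !hP ![delta_mx 0 e 0 _]mxE !eqxx.
Qed.

(** * From flatness to constant holomorphic sectional curvature *)

Section FromFlat.
Hypotheses (n_ge2 : (2 <= n)%N) (Theta : tractorEnd M).
Hypothesis hflat : forall Sig : tractorSection M,
  forall i x, chart_img i x -> forall a b : 'I_(n + n),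
    tractor_nabla2 (J i) (christoffel (g i)) a b (Sig i) x
    - tractor_nabla2 (J i) (christoffel (g i)) b a (Sig i) x
    = (2 * J i x a b) *: Theta i x (Sig i x).

Definition mu_Theta i x : 'M[R]_(n + n) :=
  \matrix_(c, e) (Theta i x (0, delta_mx 0 e, 0)).1.2 0 c.

(** The test section has a basis covector as its mu at [x] and sigma identically zero, so
    [curvature2_sigma0] reads off the coefficient of mu_e. *)
Lemma flat_equation i x a b e c : U i x ->
  Rm i a b x e c + P i x a c * (b == e)%:R - P i x b c * (a == e)%:R
  + J i x a c * (P i x *m (H i x *m J0)) b e
  - J i x b c * (P i x *m (H i x *m J0)) a e = - (2 * J i x a b * mu_Theta i x c e).
Proof.
move=> ix; have [Sig [Sx S0]] := tractorSection_through (0, delta_mx 0 e, 0) ix.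
have := hflat Sig ix a b; rewrite (nabla2_comm (@oU i) (@gsym i) _ _ _ ix).
move/(congr1 (fun t : tractor R (n + n) => t.1.2 0 c)).
rewrite (curvature2_sigma0 (@oU i) (@gsm i) (@gsym i) (@gunit i) (@gJ i) (@gcl i)
  (tsec_smooth Sig i) a b c ix (fun z _ => S0 erefl i z)).
rewrite (@mu_curv_delta i x (Sig i) a b c e ix); last by rewrite Sx.
rewrite [RHS]mxE Sx [mu_Theta i x c e]mxE.
move: (Theta i x _).1.2 => t.
move: (t 0 c) (J i x a b) (J i x a c) (J i x b c) => t' j1 j2 j3.
move: ((P i x *m _) b e) ((P i x *m _) a e) (Rm i a b x e c) => q1 q2 r.
move: (P i x a c * _) (P i x b c * _) => p1 p2 h; lra.
Qed.

Let n_gt0 : (0 < n)%N. Proof. exact: leq_trans n_ge2. Qed.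
Let c0 : 'I_(n + n) := lshift n (Ordinal n_gt0).
Let e0 : 'I_(n + n) := rshift n (Ordinal n_gt0).

(* The entry of Theta_c^e = L J_c^e at which J is 1. *)
Definition hol_curv i x : R := mu_Theta i x c0 e0.

Let J0c0e0 : J0 c0 e0 = 1.
Proof. by rewrite /std_J block_mxEur mxE eqxx. Qed.

Lemma flat_scalar i x : U i x -> P i x = hol_curv i x *: g i x /\ mu_Theta i x = hol_curv i x *: J0.
Proof.
move=> ix; have [L [PL TL]] := @flat_Einstein R n (g i x) (gsym ix) (gunit ix) (gJ ix)
  (P i x) (mu_Theta i x) (fun a b => Rm i a b x) n_gt0
  (Phi_sym (@oU i) (@gsm i) (@gsym i) (@gunit i) ix)
  (Phi_std_J (@oU i) (@gsm i) (@gsym i) (@gunit i) (@gJ i) (@gcl i) ix)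
  (fun a b => curv_mx_skew (@oU i) (@gsm i) (@gsym i) (@gunit i) a b ix)
  (fun b d => Phi_Ricci (g i) x b d)
  (fun a b e c => flat_equation a b e c ix).
suff -> : hol_curv i x = L by [].
by rewrite /hol_curv TL mxE J0c0e0 mulr1.
Qed.

Lemma hol_curv_smooth i : smooth_on (U i) (hol_curv i).
Proof.
have [_ h _] := tend_smooth Theta i (0, delta_mx 0 e0, 0).
move=> k; apply: Ck_on_eq (h c0 k); first exact: oU.
by move=> x _; rewrite /hol_curv [RHS]mxE.
Qed.

(** The test section is (1, 0, 0) at [x]. Its mu vanishes there, so [mu_curv] drops out and the
    gradient terms stand alone against the mu-part of Theta (1, 0, 0). *)
Lemma hol_curv_gradient i x a : U i x -> is_pderiv a (hol_curv i) x 0.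
Proof.
move=> ix; have [Sig [Sx _]] := tractorSection_through (1, 0, 0) ix.
pose t : 'cV[R]_(n + n) := ((Theta i x (1, 0, 0)).1.2)^T.
have PL z : U i z -> P i z = hol_curv i z *: g i z by case/flat_scalar.
have g0 : grad (hol_curv i) x = 0.
  apply: (@parallel_scale R n (g i x) (gsym ix) (gunit ix) (gJ ix) _ t
    (2 * n + 1)%:R^-1 n_ge2 erefl) => u v c.
  have := hflat Sig ix u v; rewrite (nabla2_comm (@oU i) (@gsym i) _ _ _ ix).
  move/(congr1 (fun t : tractor R (n + n) => t.1.2 0 c)).
  rewrite (curvature2_scalar (@oU i) (@gsm i) (@gsym i) (@gunit i) (@gJ i) (@gcl i)
    (tsec_smooth Sig i) (@hol_curv_smooth i) PL u v c ix).
  have -> : mu_curv (g i) (Sig i) u v c x = 0.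
    rewrite /mu_curv Sx /=.
    rewrite [X in - X](_ : _ = 0); last by apply: big1 => d _; rewrite mxE mulr0.
    have z w : \sum_d \sum_f P i x w d * Jinv_mx (g i) x d f * (0 : 'rV[R]_(n + n)) 0 f = 0.
      by apply: big1 => d _; apply: big1 => f _; rewrite mxE mulr0.
    by rewrite !z ![(0 : 'rV__) 0 _]mxE !(mulr0, oppr0, addr0, subr0).
  by rewrite add0r Sx mulr1 => ->; rewrite [LHS]mxE [t c 0]mxE.
have h := smooth_on_is_pderiv a (@hol_curv_smooth i) ix.
by move/matrixP/(_ a 0) : g0; rewrite !mxE -pdE => <-.
Qed.

(** On (0, w, 0) the mu-part of Theta is - L w J. The Jacobian commutes with J, so compatibility of
    Theta makes the difference of the two scalars annihilate w A^T J for every w. *)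
Lemma hol_curv_transition i j x : overlap i j x -> hol_curv i x = hol_curv j (transition i j x).
Proof.
move=> ij; have [ix _] := (overlapP _ _ _).1 ij.
have jx : U j (transition i j x).
  by have [] := (overlapP _ _ _).1 (transition_overlap ij).
have mu_part k y (w : 'rV[R]_(n + n)) : U k y ->
    (Theta k y (0, w, 0)).1.2 = - hol_curv k y *: (w *m J0).
  move=> ky; have lin := tend_linear Theta ky.
  pose T : {linear tractor R (n + n) -> tractor R (n + n)} :=
    HB.pack (Theta k y) (GRing.isLinear.Build _ _ _ _ _ lin).
  have -> : (0, w, 0) = \sum_e w 0 e *: ((0, delta_mx 0 e, 0) : tractor R (n + n)).
    rewrite [in LHS](row_sum_delta w); elim/big_ind2 : _ => //.
      move=> ? a ? b <- <-; apply: tractor_eq => //; exact: esym (addr0 0).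
    by move=> e _; apply: tractor_eq => //; exact: esym (mulr0 _).
  have TE v : Theta k y v = T v by [].
  rewrite TE linear_sum.
  have -> : (\sum_e T (w 0 e *: ((0, delta_mx 0 e, 0) : tractor R (n + n)))).1.2 =
      \sum_e w 0 e *: (T (0, delta_mx 0 e, 0)).1.2.
    elim/big_ind2 : _ => //; first by move=> ? a ? b <- <-.
    by move=> e _; rewrite linearZ.
  have hT e : (T (0, delta_mx 0 e, 0)).1.2 = - hol_curv k y *: row e J0.
    apply/rowP => c; have /matrixP/(_ c e) := (flat_scalar ky).2.
    rewrite [LHS]mxE => ->; rewrite mxE [RHS]mxE [row e J0 0 c]mxE.
    have /matrixP/(_ e c) := std_J_tr R n; rewrite [LHS]mxE [RHS]mxE => ->.
    by rewrite mulrN mulNr.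
  under eq_bigr do rewrite hT scalerA mulrC -scalerA.
  by rewrite -scaler_sumr mulmx_sum_row.
set A := jac (transition i j) x.
have AJ : J0 *m A = A *m J0 by exact: mtransition_holomorphic ij.
have key (w : 'rV[R]_(n + n)) :
    (hol_curv i x - hol_curv j (transition i j x)) *: (w *m A^T *m J0) = 0.
  have := tend_compat Theta ij (0, w, 0).
  move/(congr1 (fun t : tractor R (n + n) => t.1.2)).
  rewrite /tractor_pull /= !mu_part // -/A -scalemxAl => E.
  have AtJ : J0 *m A^T = A^T *m J0.
    by have := congr1 trmx AJ; rewrite !trmx_mul std_J_tr mulmxN mulNmx => /oppr_inj ->.
  move: E; rewrite -(mulmxA w J0) AtJ mulmxA !scaleNr => /oppr_inj E.
  by rewrite scalerBl E subrr.
apply/eqP; rewrite -subr_eq0; apply/negPn/negP => d0.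
have At0 : A^T = 0.
  apply/row_matrixP => k; have /eqP := key (delta_mx 0 k).
  rewrite scaler_eq0 (negPf d0) /= -rowE => /eqP h.
  have := std_JKr (row k A^T); rewrite h mul0mx => /esym/eqP.
  by rewrite oppr_eq0 => /eqP ->; rewrite row0.
(* A vanishing Jacobian would, by the transformation law, make the metric zero, against its
   invertibility. *)
have A0 : A = 0 by rewrite -[A]trmxK At0 trmx0.
have := gunit ix; rewrite (metric_tensor g ij) -/A A0 !mul0mx.
move=> /mulmxV; rewrite mul0mx => /matrixP/(_ c0 c0)/eqP.
by rewrite !mxE eqxx eq_sym oner_eq0.
Qed.

Hypothesis M_connected : connected [set: M].

Lemma hol_curv_constant : exists L : R, forall i x, U i x -> hol_curv i x = L.
Proof.
(* An empty [M] counts as connected; there any constant serves. *)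
have [[p0 _]|np] := pselect (exists p0 : M, True); last first.
  by exists 0 => i x [p _ _]; case: np; exists p.
have lamE p i j : mdom i p -> mdom j p -> hol_curv i (mchart i p) = hol_curv j (mchart j p).
  move=> di dj; have ij : overlap i j (mchart i p) by exists p.
  by rewrite (hol_curv_transition ij) /transition mchartK.
have [i0 d0] := mcover p0; pose L := hol_curv i0 (mchart i0 p0).
pose A := [set p : M | exists2 i, mdom i p & hol_curv i (mchart i p) = L].
pose B := [set p : M | exists2 i, mdom i p & hol_curv i (mchart i p) != L].
(* The scalar is constant on a ball of the chart, so both of the sets [A] and [B] are open. *)
have loc p i : mdom i p -> \forall q \near p, mdom i q /\
    hol_curv i (mchart i q) = hol_curv i (mchart i p).
  move=> di; have ip : U i (mchart i p) by exists p.
  have nb : nbhs (mchart i p) (U i) by apply: open_nbhs_nbhs.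
  have [e /= e_gt0 he] := (nbhs_ballP _ _).1 nb.
  have n1 : nbhs p (mdom i) by apply: open_nbhs_nbhs; split => //; exact: mdom_open.
  have n2 : nbhs p (mchart i @^-1` ball (mchart i p) e).
    by apply: (mchart_continuous di); exact: nbhsx_ballx.
  apply: filterS (filterI n1 n2) => q [dq bq]; split => //.
  apply: (@zero_gradient_ball _ _ e).
    by move=> z a hz; apply: hol_curv_gradient; apply: he; rewrite -ball_normE /= distrC.
  by move: bq; rewrite -ball_normE /= distrC.
have oA : open A.
  rewrite openE => p [i di Lp]; apply: filterS (loc p i di) => q [dq Lq].
  by exists i => //; rewrite Lq.
have oB : open B.
  rewrite openE => p [i di Lp]; apply: filterS (loc p i di) => q [dq Lq].
  by exists i => //; rewrite Lq.
have AB : A = ~` B.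
  apply/seteqP; split => p.
    by move=> [i di Lp] [j dj]; rewrite -(lamE p i j di dj) Lp eqxx.
  move=> nB; have [i di] := mcover p; exists i => //.
  by apply/eqP/negPn/negP => h; apply: nB; exists i.
have AT : A = [set: M].
  apply: M_connected; first by exists p0; exists i0.
  - by exists A => //; rewrite setTI.
  - by exists A; rewrite ?setTI // AB; exact: open_closedC.
exists L => i x ix; have : A (mchart_inv i x) by rewrite AT.
by move=> [j dj <-]; rewrite -(lamE _ i j (chart_img_inv ix) dj) chart_imgK.
Qed.

Lemma flat_constant_curvature : constant_holomorphic_sectional_curvature g.
Proof.
have [L hL] := hol_curv_constant; exists L => i x ix a b c d /=.
have [PL TL] := flat_scalar ix; move: PL TL; rewrite hL // => PL TL.
have -> : J i x *m (H i x)^T = J0.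
  by rewrite (invmx_sym (gsym ix)) -mulmxA (mulmxV (gunit ix)) mulmx1.
have -> : H i x *m J i x = J0.
  by rewrite /kahler_form (gJ ix) mulmxA (mulVmx (gunit ix)) mul1mx.
rewrite -curv_mx_entry; have := flat_equation a b c d ix.
rewrite PL TL -scalemxAl mulmxA (mulmxV (gunit ix)) mul1mx.
have /matrixP/(_ d c) := std_J_tr R n; rewrite mxE [RHS]mxE => J0dc.
have S1 (A : 'M[R]_(n + n)) u v : (L *: A) u v = L * A u v by rewrite mxE.
rewrite !S1 J0dc.
rewrite (eq_sym b c) (eq_sym a c) (eq_sym c b) (eq_sym c a).
move: (Rm i a b x c d) (J i x a d) (J i x b d) (J i x a b) => r j1 j2 j3.
move: (g i x a d) (g i x b d) => g1 g2.
move: (J0 b c) (J0 a c) (J0 d c) (b == c)%:R (a == c)%:R => k1 k2 k3 d1 d2 E.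
have -> : r = - (L * g1 * d1) + L * g2 * d2 - j1 * (L * k1) + j2 * (L * k2)
   - 2 * j3 * (L * k3) by lra.
ring.
Qed.

End FromFlat.

(** * From constant holomorphic sectional curvature to flatness *)

Section ToFlat.
Context (L : R).
Hypothesis hL : forall i x, chart_img i x -> forall a b c d : 'I_(n + n),
  curv (christoffel (g i)) a b c d x =
    L * ((a == c)%:R * g i x b d - (b == c)%:R * g i x a d
           + (J i x *m (H i x)^T) a c * J i x b d
           - (J i x *m (H i x)^T) b c * J i x a d
           + 2 * J i x a b * (H i x *m J i x) c d).

Let RmE i x a b c d : U i x -> Rm i a b x c d =
    L * ((a == c)%:R * g i x b d - (b == c)%:R * g i x a d
         + J0 a c * J i x b d - J0 b c * J i x a d + 2 * J i x a b * J0 c d).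
Proof.
move=> ix; rewrite curv_mx_entry hL //.
have -> : J i x *m (H i x)^T = J0.
  by rewrite (invmx_sym (gsym ix)) -mulmxA (mulmxV (gunit ix)) mulmx1.
have -> // : H i x *m J i x = J0.
by rewrite /kahler_form (gJ ix) mulmxA (mulVmx (gunit ix)) mul1mx.
Qed.

(** The trace over a = c has 2n - 1 + 0 + 1 + 2 = 2(n+1) copies of L g, exactly the normalisation of
    [Phi]. *)
Let PL i x : U i x -> P i x = L *: g i x.
Proof.
move=> ix; apply/matrixP => b d; rewrite [RHS]mxE.
have N0 : (2 * n.+1)%:R != 0 :> R by rewrite pnatr_eq0.
apply: (mulfI N0); rewrite -Phi_Ricci.
under eq_bigr do rewrite (RmE _ _ _ _ ix).
rewrite -mulr_sumr mulrCA; congr (_ * _).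
rewrite !big_split /= !sumrN -!mulr_suml.
have -> : \sum_(a < n + n) (a == a)%:R = (n + n)%:R :> R.
  by under eq_bigr do rewrite eqxx; rewrite sumr_const card_ord.
have -> : \sum_a (b == a)%:R * g i x a d = g i x b d.
  rewrite (bigD1 b) //= eqxx mul1r big1 ?addr0 // => e /negPf eb.
  by rewrite eq_sym eb mul0r.
have -> : \sum_a J0 a a = 0 by exact: std_J_trace.
have -> : \sum_a J0 b a * J i x a d = - g i x b d.
  by have /matrixP/(_ b d) := std_JK (g i x); rewrite [LHS]mxE [RHS]mxE.
have -> : \sum_a 2 * J i x a b * J0 a d = 2 * g i x b d.
  transitivity (2 * ((J i x)^T *m J0) b d).
    rewrite [in RHS]mxE mulr_sumr; apply: eq_bigr => a _.
    by rewrite [(J i x)^T b a]mxE mulrA.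
  by rewrite (kahler_skew (gsym ix) (gJ ix)) mulNmx /kahler_form (gJ ix) std_JKr opprK.
have -> : (2 * n.+1)%:R = (n + n)%:R + 2 :> R.
  by rewrite mulnS mul2n -addnn natrD addrC.
by move: (g i x b d) (n + n)%:R => *; ring.
Qed.

Definition flat_Theta_fun i x (v : tractor R (n + n)) : tractor R (n + n) :=
  (v.2, - L *: (v.1.2 *m J0), - L ^+ 2 * v.1.1).

Lemma flat_Theta_linear i x : chart_img i x -> linear (flat_Theta_fun i x).
Proof.
move=> _ k u v; rewrite /flat_Theta_fun; congr (_, _, _).
  by rewrite /= mulmxDl -scalemxAl scalerDr !scalerA [- L * k]mulrC.
change (- L ^+ 2 * (k * u.1.1 + v.1.1) = k * (- L ^+ 2 * u.1.1) + - L ^+ 2 * v.1.1).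
by ring.
Qed.

Lemma flat_Theta_smooth i v :
  tractor_smooth_on (chart_img i) (fun x => flat_Theta_fun i x v).
Proof. by split=> [k|b k|k]; exact: Ck_on_cst. Qed.

Lemma flat_Theta_compat i j x : overlap i j x -> forall v,
  flat_Theta_fun i x (tractor_pull (jac (transition i j) x) v) =
  tractor_pull (jac (transition i j) x) (flat_Theta_fun j (transition i j x) v).
Proof.
move=> ij v; rewrite /flat_Theta_fun /tractor_pull /=; congr (_, _, _).
have := mtransition_holomorphic ij; rewrite -[fun z => _]/(transition i j).
move/(congr1 trmx); rewrite !trmx_mul std_J_tr mulmxN mulNmx => /oppr_inj E.
by rewrite -mulmxA -scalemxAl E mulmxA.
Qed.

Definition flat_Theta : tractorEnd M :=
  TractorEnd flat_Theta_linear flat_Theta_smooth flat_Theta_compat.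

Lemma constant_curvature_flat : symplectically_flat g.
Proof.
exists flat_Theta => Sig i x ix a b /=.
rewrite (nabla2_comm (@oU i) (@gsym i) _ _ _ ix).
have PLi z : U i z -> P i z = L *: g i z by exact: PL.
have h1 := curvature1 (@oU i) (@gsm i) (@gsym i) (@gunit i) (@gJ i)
  (tsec_smooth Sig i) a b ix.
have h2 c := curvature2_constant (@oU i) (@gsm i) (@gsym i) (@gunit i) (@gJ i) (@gcl i)
  (tsec_smooth Sig i) PLi a b c ix.
have h3 := curvature3_constant (@oU i) (@gsm i) (@gsym i) (@gunit i) (@gJ i) (@gcl i)
  (tsec_smooth Sig i) PLi a b ix.
move: (_ - _) h1 h2 h3 => -[[s m] r] /= h1 h2 h3.
rewrite h1 h3 /flat_Theta_fun; congr (_, _, _); last first.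
  by change (- (2 * J i x a b * (L ^+ 2 * (Sig i x).1.1)) =
    2 * J i x a b * (- L ^+ 2 * (Sig i x).1.1)); rewrite mulNr mulrN.
apply/rowP => c; rewrite h2 /mu_curv !(PhiJinv_mul (@gsym i) (@gunit i) (@gJ i) PLi _ _ ix).
move: ((Sig i x).1.2) => m'.
pose Jm u := \sum_e J0 u e * m' 0 e.
(* The first four terms cancel the Phi terms of [mu_curv]; only the term with J_ab survives, and it
   is the mu-part of [flat_Theta]. *)
have -> : \sum_e Rm i a b x e c * m' 0 e = L * (g i x b c * m' 0 a
    - g i x a c * m' 0 b + J i x b c * Jm a - J i x a c * Jm b
    + 2 * J i x a b * (m' *m J0) 0 c).
  have d u : m' 0 u = \sum_e (u == e)%:R * m' 0 e.
    rewrite (bigD1 u) //= eqxx mul1r big1 ?addr0 // => e /negPf eu.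
    by rewrite eq_sym eu mul0r.
  rewrite (d a) (d b) /Jm [(m' *m J0) 0 c]mxE !mulr_sumr.
  rewrite -!sumrB -!big_split /= -!sumrB -!big_split /= mulr_sumr.
  apply: eq_bigr => e _; rewrite (RmE _ _ _ _ ix).
  move: (J i x b c) (J i x a c) (J i x a b) => *; ring.
have Pe u v : P i x u v = L * g i x u v by rewrite (PL ix) mxE.
rewrite !Pe -/(Jm a) -/(Jm b) [RHS]mxE.
have -> : (- L *: (m' *m J0)) 0 c = - L * (m' *m J0) 0 c by rewrite mxE.
move: ((m' *m J0) 0 c) (Jm a) (Jm b) (J i x b c) (J i x a c) (J i x a b) => *; ring.
Qed.

End ToFlat.
End KahlerManifold.

Theorem corollary2 (R : realType) (n : nat) (M : complexManifold R n)
    (g : kahlerMetric M) (n_ge2 : (2 <= n)%N)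
    (M_connected : connected [set: M]) :
  symplectically_flat g <-> constant_holomorphic_sectional_curvature g.
Proof.
split=> [[T hflat]|[L hL]].
  apply: (flat_constant_curvature (Theta := T) n_ge2 _ M_connected).
  by move=> Sig i x ix a b; exact: hflat.
exact: constant_curvature_flat hL.
Qed.
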